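(* Let $h/k$ be a field extension and $(h_n)_{n\in\mathbb{N}}$ an increasing sequence of subfields of $h$ containing $k$ with $h=\bigcup_nh_n$, such that for every $n$, $h_n/k$ is an outer Galois extension of finite degree $d_n$ with $\mathrm{Gal}(h_n/k)$ cyclic, generated by $\sigma_n$, and $\sigma_n|_{h_m}=\sigma_m$ for $m\le n$. Suppose that for all $n$, $d_{n+1}/d_n$ and $d_n$ are coprime. Let $\mathbf{k}\subset Z(k)$ be a commutative subfield. Then there exists a sequence $(l_n)_{n\in\mathbb{N}}$ of positive integers with $l_n\mid l_{n+1}$, $d_n\mid \frac{l_{n+1}}{l_n}-1$ and $d_n\mid l_n$ for all $n$. Moreover, for any such sequence, letting $H=\varinjlim h_n(t,\sigma_n)$ with transition morphisms $h_n(t,\sigma_n)\to h_{n+1}(t,\sigma_{n+1})$, $P(t)\mapsto P(t^{l_{n+1}/l_n})$ (identity on $h_n$): if $\mathrm{SIGP}_{\mathbf{k}}$ holds, then $\mathrm{IGP}_H$ holds.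
   Context: ''Field'' means a not necessarily commutative division ring; $Z(A)$ is the center of $A$. For a field $h$ and automorphism $\sigma$, $h(t,\sigma)$ is the field of fractions of the ring $h[t,\sigma]$ of polynomials $\sum a_it^i$ with $ta=\sigma(a)t$. $h/k$ is outer if the only inner automorphism of $h$ fixing $k$ pointwise is the identity; $\mathrm{Gal}(h/k)$ is the group of automorphisms of $h$ fixing $k$ pointwise and $h/k$ is Galois if its fixed field is $k$. $\mathrm{SIGP}_{\mathbf{k}}$ (for a commutative field $\mathbf{k}$): for every finite group $G$ there is a field $L$ with $\mathbf{k}(t)\subset L\subset\mathbf{k}((t))$ such that $L/\mathbf{k}(t)$ is Galois with group $G$. $\mathrm{IGP}_H$: every finite group is the Galois group of an outer Galois extension of $H$. *)

(* Defs.v *)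
From HB Require Import structures.
From mathcomp Require Import all_boot all_order all_algebra all_fingroup.
From mathcomp Require Import fraction.
Set Implicit Arguments. Unset Strict Implicit. Unset Printing Implicit Defensive.
Import GRing.Theory.
Local Open Scope ring_scope.

(* A "field" in the paper = (not necessarily commutative) division ring:
   a (nontrivial) unit ring in which every nonzero element is invertible. *)
Definition is_divring (R : unitRingType) : Prop :=
  forall x : R, x != 0 -> x \is a GRing.unit.

Definition subdivring (R : unitRingType) (A : R -> Prop) : Prop :=
  [/\ A 0, A 1, (forall x y, A x -> A y -> A (x - y)),
      (forall x y, A x -> A y -> A (x * y)) & (forall x, A x -> A x^-1)].

Definition gen_divring (R : unitRingType) (S : R -> Prop) (x : R) : Prop :=
  forall P : R -> Prop, subdivring P -> (forall y, S y -> P y) -> P x.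

Definition ring_aut_on (R : unitRingType) (A : R -> Prop) (f : R -> R) : Prop :=
  [/\ (forall x, A x -> A (f x)),
      (forall x y, A x -> A y -> f x = f y -> x = y),
      (forall y, A y -> exists2 x, A x & f x = y),
      (forall x y, A x -> A y -> f (x + y) = f x + f y) &
      ((forall x y, A x -> A y -> f (x * y) = f x * f y) /\ f 1 = 1)].

Definition in_Gal (R : unitRingType) (A B : R -> Prop) (f : R -> R) : Prop :=
  ring_aut_on A f /\ (forall x, B x -> f x = x).

Definition galois_ext (R : unitRingType) (A B : R -> Prop) : Prop :=
  forall x, A x -> (forall f, in_Gal A B f -> f x = x) -> B x.

Definition outer_ext (R : unitRingType) (A B : R -> Prop) : Prop :=
  forall u, A u -> u != 0 -> (forall b, B b -> u * b * u^-1 = b) ->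
    forall x, A x -> u * x * u^-1 = x.

Definition left_degree (R : unitRingType) (A B : R -> Prop) (d : nat) : Prop :=
  exists b : 'I_d -> R,
    [/\ (forall i, A (b i)),
        (forall x, A x -> exists c : 'I_d -> R,
             (forall i, B (c i)) /\ x = \sum_i c i * b i) &
        (forall c : 'I_d -> R, (forall i, B (c i)) ->
             \sum_i c i * b i = 0 -> forall i, c i = 0)].

Definition gal_cyclic_gen (R : unitRingType) (A B : R -> Prop) (s : R -> R) : Prop :=
  in_Gal A B s /\
  forall f, in_Gal A B f -> exists i : nat, forall x, A x -> f x = iter i s x.

Definition gal_group_iso (R : unitRingType) (A B : R -> Prop)
    (gT : finGroupType) (G : {group gT}) : Prop :=
  exists f : gT -> R -> R,
    [/\ (forall g, g \in G -> in_Gal A B (f g)),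
        (forall g1 g2, g1 \in G -> g2 \in G ->
            forall x, A x -> f (g1 * g2)%g x = f g1 (f g2 x)),
        (forall g1 g2, g1 \in G -> g2 \in G ->
            (forall x, A x -> f g1 x = f g2 x) -> g1 = g2) &
        (forall s, in_Gal A B s -> exists2 g, g \in G & forall x, A x -> s x = f g x)].

Definition laurent_valid (K : fieldType) (f : int -> K) : Prop :=
  exists N : int, forall n : int, n < N -> f n = 0.

Definition laurent_mul_rel (K : fieldType) (f g h : int -> K) : Prop :=
  forall a b : int, (forall n : int, n < a -> f n = 0) -> (forall n : int, n < b -> g n = 0) ->
  forall n : int, h n = if a + b <= n then
                    \sum_(j < (absz (n - a - b)%R).+1) f (a + j%:Z) * g (n - a - j%:Z)
                  else 0.

Definition laurent_delta (K : fieldType) (m : int) : int -> K :=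
  fun n => if n == m then 1 else 0.

(* K(t) = fraction field of K[t];  j : K(t) -> L and L embeds in K((t)) by a ring
   embedding iota whose composite with j is the standard inclusion K(t) c K((t))
   (t |-> t, constants |-> constants), i.e. K(t) c L c K((t)). *)
Definition between_rat_laurent (K L : fieldType)
    (j : {rmorphism {fraction {poly K}} -> L}) : Prop :=
  exists iota : L -> int -> K,
    [/\ (forall x, laurent_valid (iota x)),
        (forall x y, (forall n, iota x n = iota y n) -> x = y),
        (forall x y n, iota (x + y) n = iota x n + iota y n),
        (forall x y, laurent_mul_rel (iota x) (iota y) (iota (x * y))) &
        ((forall (c : K) n, iota (j (tofrac c%:P)) n = c * laurent_delta K 0 n) /\
         (forall n, iota (j (tofrac 'X)) n = laurent_delta K 1 n))].

Definition SIGP (K : fieldType) : Prop :=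
  forall (gT : finGroupType) (G : {group gT}),
  exists (L : fieldType) (j : {rmorphism {fraction {poly K}} -> L}),
    [/\ between_rat_laurent j,
        galois_ext (fun _ : L => True) (fun x => exists r, x = j r) &
        gal_group_iso (fun _ : L => True) (fun x => exists r, x = j r) G].

Definition IGP (H : unitRingType) : Prop :=
  forall (gT : finGroupType) (G : {group gT}),
  exists (H' : unitRingType) (psi : {rmorphism H -> H'}),
    [/\ is_divring H',
        outer_ext (fun _ : H' => True) (fun x => exists a, x = psi a),
        galois_ext (fun _ : H' => True) (fun x => exists a, x = psi a) &
        gal_group_iso (fun _ : H' => True) (fun x => exists a, x = psi a) G].

Definition good_seq (d l : nat -> nat) : Prop :=
  forall n, [/\ (0 < l n)%N, (l n %| l n.+1)%N,
               (d n %| l n.+1 %/ l n - 1)%N & (d n %| l n)%N].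

(* H (with phi : h -> H and T_n in H) is the direct limit of the skew fields
   h_n(t, sigma_n) along P(t) |-> P(t^(l_{n+1}/l_n)):
   T_n plays the role of the variable t of h_n(t,sigma_n); h_n[T_n, sigma_n] is
   a skew polynomial ring (injectivity), the division subring H_n generated by
   phi(h_n) and T_n is then (isomorphic to) its field of fractions h_n(t,sigma_n),
   the inclusions H_n c H_{n+1} are the transition maps (T_n = T_{n+1}^(l_{n+1}/l_n)),
   and H is the union of the H_n. *)
Definition is_skew_limit (h : unitRingType) (hs : nat -> h -> Prop)
    (sigma : nat -> h -> h) (l : nat -> nat)
    (H : unitRingType) (phi : {rmorphism h -> H}) (T : nat -> H) : Prop :=
  [/\ is_divring H,
      (forall n, T n = T n.+1 ^+ (l n.+1 %/ l n)%N),
      (forall n a, hs n a -> T n * phi a = phi (sigma n a) * T n),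
      (forall n (m : nat) (c : nat -> h), (forall i, hs n (c i)) ->
          \sum_(i < m) phi (c i) * T n ^+ i = 0 -> forall i, (i < m)%N -> c i = 0) &
      (forall x : H, exists n,
          gen_divring (fun y => y = T n \/ exists a, hs n a /\ y = phi a) x)].

(* Main.v *)
Require Import Defs.
From HB Require Import structures.
From mathcomp Require Import all_boot all_order all_algebra all_fingroup.
From mathcomp Require Import fraction generic_quotient boolp.
Set Implicit Arguments. Unset Strict Implicit. Unset Printing Implicit Defensive.
Import GRing.Theory.
Local Open Scope ring_scope.

(* Let s = T_n ^ l_n, which does not depend on n. Since the generator sigma_n of an outer cyclic
   Galois group has order d_n, and d_n divides l_n, the element s is central in H; as K is central
   in h by outerness, K(s) is a central subfield of H. Given a finite group G, realize it by L with
   K(t) < L < K((t)) and put H' := H (x)_{K(s)} L. The factor L is central in H', so H'/H is outer,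
   and the Galois group of L acts on H' with fixed ring H; by linear independence of conjugations
   every H-automorphism of H' comes from G.

   The point is that H' is a division ring. It is finite over H, so it suffices to exclude zero
   divisors. Elements of H' with coordinates in h_n[T_n, sigma_n] are approximated T_n-adically by
   elements of h_n[T_n, sigma_n], replacing the elements of L by truncations of their Laurent series
   in s. The approximation is multiplicative, the T_n-adic valuation is additive, and the
   approximation is faithful because h_n and K((s)) are linearly disjoint over K. *)

(** * Linear algebra over division rings *)

(** Passing from zero divisors to inverses requires care with denominators. The coordinates of a
    nonzero [x] are left fractions over the skew polynomials of one stage, and a left denominator
    cannot be carried past another factor of a product. Hence [x] is first multiplied on the left
    until its coordinates are skew polynomials. Its powers leave that ring only through the
    structure constants of [L] over [K(t)], whose denominators are polynomials in the central
    element [s], and these do pass through products. So zero divisors need to be excluded only among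
    elements with central denominators, which reduces to polynomial coordinates. A linear relation
    between powers of [x], from which factors [x] are cancelled on the right, then gives a left
    inverse. Truncations replace an embedding into skew Laurent series: only congruences modulo
    powers of [T_n] inside [H] are compared. *)

Section SubDivRing.
Variables (R : unitRingType) (A : R -> Prop).
Hypothesis sA : subdivring A.

Lemma subdivring0 : A 0. Proof. by case: sA. Qed.
Lemma subdivring1 : A 1. Proof. by case: sA. Qed.
Lemma subdivringB x y : A x -> A y -> A (x - y).
Proof. by case: sA => _ _ + _ _; apply. Qed.
Lemma subdivringN x : A x -> A (- x).
Proof. by move=> Ax; rewrite -sub0r; apply: subdivringB => //; apply: subdivring0. Qed.
Lemma subdivringD x y : A x -> A y -> A (x + y).
Proof. by move=> Ax Ay; rewrite -[y]opprK; apply: subdivringB => //; apply: subdivringN. Qed.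
Lemma subdivringM x y : A x -> A y -> A (x * y).
Proof. by case: sA => _ _ _ + _; apply. Qed.
Lemma subdivringV x : A x -> A x^-1.
Proof. by case: sA => _ _ _ _; apply. Qed.
Lemma subdivringX x n : A x -> A (x ^+ n).
Proof.
move=> Ax; elim: n => [|n IH]; first by rewrite expr0; apply: subdivring1.
by rewrite exprS; apply: subdivringM.
Qed.
Lemma subdivring_sum (I : Type) (r : seq I) (P : pred I) (F : I -> R) :
  (forall i, A (F i)) -> A (\sum_(i <- r | P i) F i).
Proof.
move=> AF; apply: (big_ind A) => //; [exact: subdivring0 | exact: subdivringD].
Qed.
End SubDivRing.

Lemma divring_mulf_neq0 (R : unitRingType) (x y : R) :
  is_divring R -> x != 0 -> y != 0 -> x * y != 0.
Proof.
move=> dR /dR Ux; apply: contra_neq => xy0.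
by apply: (mulrI Ux); rewrite xy0 mulr0.
Qed.

(** Gaussian elimination on the number of equations, using only operations inside [A], so that the
    solution stays in [A]. *)
Lemma left_dependence_ord (R : unitRingType) (A : R -> Prop) (n m : nat)
    (a : 'I_n -> 'I_m -> R) :
  is_divring R -> subdivring A -> (forall i j, A (a i j)) -> (n < m)%N ->
  exists c : 'I_m -> R, [/\ forall j, A (c j), exists j, c j != 0 &
                          forall i, \sum_j c j * a i j = 0].
Proof.
move=> dR sA; elim: n m a => [|n IH] [//|m] a Aa ltnm.
  exists (fun=> 1); split=> [j||[]//]; first exact: subdivring1.
  by exists ord0; rewrite oner_neq0.
have [[j0 nz]|allz] := pselect (exists j, a ord_max j != 0).
  (* Unknowns stand on the left, so column [j0] is subtracted from column [j] with the left factor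
     [q j], which clears the last row. *)
  pose q j := a ord_max j * (a ord_max j0)^-1.
  have Aq j : A (q j) by apply: (subdivringM sA) => //; apply: (subdivringV sA).
  pose a' (i : 'I_n) (j : 'I_m) :=
    a (widen_ord (leqnSn n) i) (lift j0 j) - q (lift j0 j) * a (widen_ord (leqnSn n) i) j0.
  have [i j||c [Ac [j1 c1] rel]] := IH m a'; last 1 first.
  - pose c' j := if unlift j0 j is Some j' then c j'
                 else - \sum_j' c j' * q (lift j0 j').
    exists c'; split.
    + move=> j; rewrite /c'; case: unliftP => // _.
      apply: (subdivringN sA); apply: (subdivring_sum sA) => i.
      exact: (subdivringM sA).
    + by exists (lift j0 j1); rewrite /c' liftK.
    + move=> i; rewrite (bigD1_ord j0) //= /c' unlift_none.
      under eq_bigr do rewrite liftK.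
      rewrite mulNr mulr_suml addrC; apply/eqP; rewrite subr_eq0; apply/eqP.
      have [i' ->|->] := unliftP ord_max i.
        apply/eqP; rewrite -subr_eq0 -sumrB; apply/eqP.
        rewrite -[RHS](rel i'); apply: eq_bigr => j _.
        have -> : lift ord_max i' = widen_ord (leqnSn n) i'.
          by apply: val_inj; rewrite /= /bump leqNgt ltn_ord.
        by rewrite /a' mulrBr !mulrA.
      apply: eq_bigr => j _; rewrite /q -!mulrA mulVr ?mulr1 //; exact: dR.
  - by apply: (subdivringB sA) => //; apply: (subdivringM sA).
  - by [].
have [i j||c [Ac c1 rel]] := IH m.+1 (fun i => a (widen_ord (leqnSn n) i)).
- exact: Aa.
- exact: ltnW.
exists c; split=> // i; have [i' ->|->] := unliftP ord_max i.
  have -> : lift ord_max i' = widen_ord (leqnSn n) i'; last exact: rel.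
  by apply: val_inj; rewrite /= /bump leqNgt ltn_ord.
rewrite big1 // => j _; have [->|nz] := eqVneq (a ord_max j) 0; first by rewrite mulr0.
by case: allz; exists j.
Qed.

Lemma left_dependence (R : unitRingType) (A : R -> Prop) (I J : finType)
    (a : I -> J -> R) :
  is_divring R -> subdivring A -> (forall i j, A (a i j)) -> (#|I| < #|J|)%N ->
  exists c : J -> R, [/\ forall j, A (c j), exists j, c j != 0 &
                       forall i, \sum_j c j * a i j = 0].
Proof.
move=> dR sA Aa lt; have [i j|c [Ac [j cj] rel]] :=
  left_dependence_ord (a := fun i j => a (enum_val i) (enum_val j)) dR sA _ lt.
  exact: Aa.
exists (c \o enum_rank); split=> [x||i]; first exact: Ac.
  by exists (enum_val j); rewrite /= enum_valK.
rewrite (reindex_onto (@enum_val J J) enum_rank) => [|j' _]; last exact: enum_rankK.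
rewrite (eq_bigl xpredT) => [|j']; last by rewrite /= enum_valK eqxx.
rewrite -[RHS](rel (enum_rank i)); apply: eq_bigr => j' _.
by rewrite /= enum_valK enum_rankK.
Qed.

Lemma subdivring_converse (R : unitRingType) (A : R -> Prop) :
  subdivring A -> subdivring (A : R^c -> Prop).
Proof. by case=> A0 A1 AB AM AV; split=> // x y Ax Ay; apply: AM. Qed.

Lemma right_dependence (R : unitRingType) (A : R -> Prop) (I J : finType)
    (a : I -> J -> R) :
  is_divring R -> subdivring A -> (forall i j, A (a i j)) -> (#|I| < #|J|)%N ->
  exists c : J -> R, [/\ forall j, A (c j), exists j, c j != 0 &
                       forall i, \sum_j a i j * c j = 0].
Proof.
move=> dR sA Aa lt.
exact: (@left_dependence R^c A I J a dR (subdivring_converse sA) Aa lt).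
Qed.

(** Shortest-relation argument. Over a division ring, distinctness of the [g i] is not enough: [out]
    says that no nonzero element of [A] intertwines two of them. *)
Lemma dedekind_independence (R : unitRingType) (A : R -> Prop) (I : finType)
    (g : I -> R -> R) (u : I -> R) :
  is_divring R -> subdivring A ->
  (forall i x, A x -> A (g i x)) -> (forall i, g i 1 = 1) ->
  (forall i x y, A x -> A y -> g i (x * y) = g i x * g i y) ->
  (forall i j v, A v -> v != 0 -> (forall y, A y -> g i y * v = v * g j y) -> i = j) ->
  (forall i, A (u i)) -> (forall x, A x -> \sum_i g i x * u i = 0) ->
  forall i, u i = 0.
Proof.
move=> dR sA Ag g1 gM out.
have [m] := ubnP #|[set i | u i != 0]|; elim: m u => // m IH u lem Au rel i0.
apply/eqP/negPn/negP => nz0.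
have [u' u'E] : exists u', forall i, u' i = u i * (u i0)^-1 by exists (fun i => u i * (u i0)^-1).
have Au' i : A (u' i) by rewrite u'E; apply: (subdivringM sA) => //; apply: (subdivringV sA).
have u'0 : u' i0 = 1 by rewrite u'E mulrV //; apply: dR.
have rel' x : A x -> \sum_i g i x * u' i = 0.
  by move=> Ax; under eq_bigr do rewrite u'E mulrA; rewrite -mulr_suml rel ?mul0r.
(* Substituting [x * y] for [x] and subtracting the relation multiplied on the right by [g i0 y]
   cancels the term [i0], where [u' i0 = 1]. The shorter relation is trivial, so each [u' i]
   intertwines [g i] and [g i0]. *)
have comm y : A y -> forall i, g i y * u' i - u' i * g i0 y = 0.
  move=> Ay; apply: IH.
  - rewrite -ltnS; apply: leq_trans lem; rewrite ltnS; apply: proper_card.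
    apply/properP; split.
      apply/subsetP => i; rewrite !inE; apply: contraNneq => ui0.
      by rewrite u'E ui0 !mul0r mulr0 subr0.
    by exists i0; rewrite !inE // negbK u'0 mulr1 mul1r subrr.
  - by move=> i; apply: (subdivringB sA); apply: (subdivringM sA) => //; apply: Ag.
  move=> x Ax; under eq_bigr do rewrite mulrBr !mulrA -gM //.
  rewrite sumrB rel'; last exact: (subdivringM sA).
  by rewrite -mulr_suml rel' // mul0r subrr.
have uz i : i != i0 -> u' i = 0.
  move=> ne; apply/eqP/negPn/negP => nz; case/eqP: ne.
  apply: (out i i0 (u' i)) => // y Ay; apply/eqP; rewrite -subr_eq0; apply/eqP.
  exact: comm.
have := rel' 1 (subdivring1 sA); rewrite (bigD1 i0) //= big1 => [|i /uz->]; last by rewrite mulr0.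
by move/eqP; rewrite addr0 g1 u'0 mulr1 oner_eq0.
Qed.

(** * Outer cyclic extensions *)

Section Automorphisms.
Variables (R : unitRingType) (A : R -> Prop) (f : R -> R).
Hypothesis (sA : subdivring A) (fA : ring_aut_on A f).

Lemma aut_stable x : A x -> A (f x). Proof. by case: fA => + _ _ _ _; apply. Qed.
Lemma autD x y : A x -> A y -> f (x + y) = f x + f y.
Proof. by case: fA => _ _ _ + _; apply. Qed.
Lemma autM x y : A x -> A y -> f (x * y) = f x * f y.
Proof. by case: fA => _ _ _ _ [+ _]; apply. Qed.
Lemma aut1 : f 1 = 1. Proof. by case: fA => _ _ _ _ []. Qed.
Lemma aut0 : f 0 = 0.
Proof.
by apply: (@addrI _ (f 0)); rewrite -autD ?addr0 //; apply: subdivring0.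
Qed.
Lemma aut_inj x y : A x -> A y -> f x = f y -> x = y.
Proof. by case: fA => _ + _ _ _; apply. Qed.
Lemma aut_sum (I : finType) (F : I -> R) :
  (forall i, A (F i)) -> f (\sum_i F i) = \sum_i f (F i).
Proof.
move=> AF; suff [] : A (\sum_i F i) /\ f (\sum_i F i) = \sum_i f (F i) by [].
elim/big_ind2: _ => //; first by split; [exact: subdivring0 | exact: aut0].
by move=> x1 x2 y1 y2 [Ax <-] [Ay <-]; rewrite autD //; split=> //; apply: subdivringD.
Qed.
Lemma aut_iter_closed m x : A x -> A (iter m f x).
Proof. by move=> Ax; elim: m => //= m; apply: aut_stable. Qed.
Lemma aut_iterM m x y : A x -> A y -> iter m f (x * y) = iter m f x * iter m f y.
Proof. by move=> Ax Ay; elim: m => //= m ->; rewrite autM //; apply: aut_iter_closed. Qed.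
Lemma aut_iter1 m : iter m f 1 = 1.
Proof. by elim: m => //= m ->; rewrite aut1. Qed.
Lemma aut_iter_inj m x y : A x -> A y -> iter m f x = iter m f y -> x = y.
Proof.
by move=> Ax Ay; elim: m => //= m IH /aut_inj e; apply/IH/e; apply: aut_iter_closed.
Qed.
Lemma aut_iter_sum m (I : finType) (F : I -> R) :
  (forall i, A (F i)) -> iter m f (\sum_i F i) = \sum_i iter m f (F i).
Proof.
move=> AF; elim: m => //= m ->; rewrite aut_sum // => i; exact: aut_iter_closed.
Qed.
End Automorphisms.

Lemma aut_iter_fix (R : Type) (f : R -> R) m x : f x = x -> iter m f x = x.
Proof. by move=> fx; elim: m => //= m ->. Qed.

(* Independence of automorphisms, which uses outerness, bounds the order of the generator by the
   degree; Artin's descent on minimal relations gives the converse. *)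
Section OuterCyclicDegree.
Variables (R : unitRingType) (A B : R -> Prop) (s : R -> R) (d : nat).
Hypotheses (dR : is_divring R) (sA : subdivring A).
Hypotheses (BA : forall x, B x -> A x) (outA : outer_ext A B) (galA : galois_ext A B).
Hypotheses (degA : left_degree A B d) (cycA : gal_cyclic_gen A B s).

Let sG : ring_aut_on A s. Proof. by case: cycA => [[]]. Qed.
Let sfix x : B x -> s x = x. Proof. by case: cycA => [[_ +] _]; apply. Qed.

(** Otherwise the [d + 1] powers of [s] up to [s^d] are independent. But the [d] equations indexed
    by the basis [b] have a nonzero right solution [u], which extends from [b] to [A] because [s] is
    left [B]-linear. *)
Lemma generator_order_le : exists2 r, (0 < r <= d)%N & forall x, A x -> iter r s x = x.
Proof.
apply: contrapT => nor; case: degA => b [Ab spanb _].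
have [i j||u [Au [i0 nz] rel]] :=
  @right_dependence R A 'I_d 'I_d.+1 (fun j i => iter i s (b j)) dR sA.
- exact: (aut_iter_closed sG).
- by rewrite !card_ord.
case/eqP: nz; apply: (@dedekind_independence R A _ (fun i : 'I_d.+1 => iter i s)) i0 => //.
- by move=> i x; apply: (aut_iter_closed sG).
- by move=> i; apply: (aut_iter1 sG).
- by move=> i x y; apply: (aut_iterM sG).
(* An intertwiner [v] of two powers of [s] commutes with [B], which [s] fixes; by outerness it
   centralizes [A], so the two powers agree. *)
- move=> i j v Av nzv comm.
  have Uv := dR nzv.
  have cv x : A x -> x * v = v * x.
    move=> Ax; rewrite -[in LHS](outA Av nzv _ Ax) ?mulrVK // => y By.
    have := comm y (BA By); rewrite !(aut_iter_fix _ (sfix By)) => <-.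
    by rewrite mulrK.
  have eqij y : A y -> iter i s y = iter j s y.
    move=> Ay; apply: (mulIr Uv); rewrite comm // cv //.
    exact: (aut_iter_closed sG).
  have key (i' j' : 'I_d.+1) : (i' < j')%N ->
      (forall y, A y -> iter i' s y = iter j' s y) -> False.
    move=> lt e; apply: nor; exists (j' - i')%N.
      by rewrite subn_gt0 lt (leq_trans (leq_subr _ _)) // -ltnS.
    move=> y Ay; apply: (aut_iter_inj sG (m := i')) => //.
      exact: (aut_iter_closed sG).
    by rewrite -iterD subnKC ?e // ltnW.
  apply: val_inj; case: (ltngtP i j) => // lt; first by case: (key i j lt).
  by case: (key j i lt) => y /eqij.
move=> x /spanb[c [Bc ->]].
under eq_bigr => i _.
  rewrite (aut_iter_sum sA sG); last by move=> j; apply: (subdivringM sA) => //; apply: BA.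
  rewrite mulr_suml; under eq_bigr => j _.
    rewrite (aut_iterM sG) //; last exact: BA.
    rewrite (aut_iter_fix _ (sfix (Bc j))) -mulrA.
  over.
over.
rewrite exchange_big big1 //= => j _.
by rewrite -mulr_sumr rel mulr0.
Qed.

Lemma generator_order_ge r : (0 < r)%N -> (forall x, A x -> iter r s x = x) -> (d <= r)%N.
Proof.
move=> r0 sr; case: degA => b [Ab _ freeb].
have sper m x : A x -> iter m s x = iter (m %% r) s x.
  move=> Ax; rewrite {1}(divn_eq m r) addnC iterD.
  congr iter; elim: (m %/ r)%N => // q IH.
  by rewrite mulSn iterD IH sr.
have indep c : (forall j, A (c j)) -> (forall i, \sum_j c j * iter i s (b j) = 0) ->
    forall j, c j = 0.
  have [m] := ubnP #|[set j | c j != 0]|; elim: m c => // m IH c lem Ac rel j0.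
  apply/eqP/negPn/negP => nz0.
  pose c' j := (c j0)^-1 * c j.
  have Ac' j : A (c' j) by apply: (subdivringM sA) => //; apply: (subdivringV sA).
  have c'0 : c' j0 = 1 by rewrite /c' mulVr //; apply: dR.
  have rel' i : \sum_j c' j * iter i s (b j) = 0.
    by rewrite /c'; under eq_bigr do rewrite -mulrA; rewrite -mulr_sumr rel mulr0.
  (* Applying [s] to the relation of index [i - 1] gives that of index [i] with coefficients
     [s (c' j)]. The difference lacks the term [j0], so each [c' j] is fixed by [s], hence by the
     whole group, and lies in [B]. *)
  have fixc j : s (c' j) - c' j = 0.
    move: j; apply: IH.
    - rewrite -ltnS; apply: leq_trans lem; rewrite ltnS; apply: proper_card.
      apply/properP; split.
        apply/subsetP => i; rewrite !inE; apply: contraNneq => ui0.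
        by rewrite /c' ui0 mulr0 (aut0 sA sG) subrr.
      by exists j0; rewrite !inE // negbK c'0 (aut1 sG) subrr.
    - by move=> j; apply: (subdivringB sA) => //; apply: (aut_stable sG).
    move=> i; under eq_bigr do rewrite mulrBl.
    rewrite sumrB rel' subr0.
    (* The index [i] needs a predecessor even when it is 0; adding the period [r] supplies one. *)
    have [q eq_iq] : exists q, forall x, A x -> iter i s x = iter q.+1 s x.
      exists (i + r).-1 => x Ax; rewrite prednK ?addn_gt0 ?r0 ?orbT //.
      by rewrite iterD sr.
    under eq_bigr => j _ do
      rewrite (eq_iq _ (Ab j)) /= -(autM sG (Ac' j) (aut_iter_closed sG _ (Ab j))).
    rewrite -(aut_sum sA sG) ?rel' ?(aut0 sA sG) // => j.
    by apply: (subdivringM sA) => //; apply: (aut_iter_closed sG).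
  have Bc j : B (c' j).
    apply: galA => // f; case: cycA => _ gen /gen[i ->] //.
    by apply: aut_iter_fix; apply/eqP; rewrite -subr_eq0 fixc.
  by have /eqP := freeb c' Bc (rel' 0) j0; rewrite c'0 oner_eq0.
rewrite leqNgt; apply/negP => ltrd.
have [i j||c [Ac [j nz] rel]] :=
  @left_dependence R A 'I_r 'I_d (fun i j => iter i s (b j)) dR sA.
- exact: (aut_iter_closed sG).
- by rewrite !card_ord.
case/eqP: nz; apply: indep => // i.
rewrite -[RHS](rel (Ordinal (ltn_pmod i r0))); apply: eq_bigr => j' _ /=.
by rewrite sper.
Qed.

Lemma outer_cyclic_degree_gt0 : (0 < d)%N.
Proof. by have [r /andP[r0 /(leq_trans r0)]] := generator_order_le. Qed.

Lemma outer_cyclic_generator_order m :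
  (forall x, A x -> iter m s x = x) <-> (d %| m)%N.
Proof.
have [r /andP[r0 rd] sr] := generator_order_le.
have dr : d = r by apply/eqP; rewrite eqn_leq rd andbT; apply: generator_order_ge.
have {r r0 rd sr dr} sd x : A x -> iter d s x = x by rewrite dr; apply: sr.
have per q x : A x -> iter (q * d) s x = x.
  by move=> Ax; elim: q => // q IH; rewrite mulSn iterD IH sd.
split=> [sm|/dvdnP[q ->] x]; last exact: per.
rewrite /dvdn -leqn0 leqNgt; apply/negP => mpos.
suff /(generator_order_ge mpos) : forall x, A x -> iter (m %% d) s x = x.
  by rewrite leqNgt ltn_pmod ?outer_cyclic_degree_gt0.
by move=> x Ax; rewrite -[RHS](sm x Ax) {2}(divn_eq m d) addnC iterD per.
Qed.

End OuterCyclicDegree.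

(** The ratio [m n] of consecutive terms must be 1 modulo [d n], so that [sigma_(n+1) ^ m n] agrees
    with [sigma_n] on [h_n], and a multiple of [q n], so that [d n.+1] divides [l n.+1]. Coprimality
    allows both. *)
Lemma coprime_tower_good_seq (d : nat -> nat) :
  (forall n, 0 < d n)%N -> (forall n, d n %| d n.+1)%N ->
  (forall n, coprime (d n.+1 %/ d n) (d n)) -> exists l, good_seq d l.
Proof.
move=> d0 dd cop.
pose q n := (d n.+1 %/ d n)%N.
(* The summand [d n * q n] changes neither congruence and makes [m n] positive. *)
pose m n := (chinese (d n) (q n) 1 0 + d n * q n)%N.
have q0 n : (0 < q n)%N by rewrite divn_gt0 // dvdn_leq.
have m0 n : (0 < m n)%N by rewrite addn_gt0 muln_gt0 d0 q0 orbT.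
have qm n : (q n %| m n)%N.
  rewrite dvdn_addl ?dvdn_mull // /dvdn chinese_modr ?mod0n // coprime_sym; exact: cop.
have dm n : (d n %| m n - 1)%N.
  rewrite -eqn_mod_dvd // /m addnC mulnC modnMDl chinese_modl // coprime_sym.
  exact: cop.
pose l := fix l n := if n is n'.+1 then (l n' * m n')%N else d 0%N.
have l0 n : (0 < l n)%N by elim: n => //= n IH; rewrite muln_gt0 IH m0.
exists l => n; split=> //=.
- exact: dvdn_mulr.
- by rewrite mulKn.
elim: n => //= n IH; have -> : d n.+1 = (d n * q n)%N by rewrite mulnC divnK.
exact: dvdn_mul.
Qed.

(** * Galois bases *)

Lemma sum_mul_delta (R : nzRingType) (I : finType) (x : I -> R) k :
  \sum_i x i * (i == k)%:R = x k.
Proof.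
rewrite (bigD1 k) //= eqxx mulr1 big1 ?addr0 // => i /negPf->.
by rewrite mulr0.
Qed.

(** Vectors without a common nonzero annihilator span [K^I], so [|I|] of them form an invertible
    matrix, with inverse [B]. *)
Lemma dual_family (K : fieldType) (X : Type) (I : finType) (w : X -> I -> K) :
  (forall a : I -> K, (forall x, \sum_i a i * w x i = 0) -> forall i, a i = 0) ->
  exists (x : I -> X) (B : I -> I -> K),
    (forall i k, \sum_l B i l * w (x l) k = (i == k)%:R) /\
    (forall i k, \sum_l w (x i) l * B l k = (i == k)%:R).
Proof.
move=> annih; set n := #|I|.
pose rw x : 'rV[K]_n := \row_k w x (enum_val k).
have ex_free r : (r <= n)%N ->
    exists x : 'I_r -> X, row_free (\matrix_(i < r) rw (x i)).
  elim: r => [_|r IH ltrn].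
    by exists (fun i : 'I_0 => False_rect _ (notF (ltn_ord i))); rewrite /row_free flatmx0 mxrank0.
  have [x free_x] := IH (ltnW ltrn); set M := \matrix_i _ in free_x.
  (* A nonzero column of the cokernel kills the rows chosen so far; by [annih] some [w y] does not
     kill it, so [y] enlarges the free family. *)
  have /matrix0Pn[i0 [j nz]] : cokermx M != 0.
    by rewrite cokermx_eq0 /row_full (eqP free_x) ltn_eqF.
  have [y ynz] : exists y, rw y *m col j (cokermx M) != 0.
    apply: contrapT => nex; case/eqP: nz.
    suff H : forall i, cokermx M (enum_rank i) j = 0 by rewrite -(H (enum_val i0)) enum_valK.
    apply: annih => y; apply/eqP; apply: contrapT => /negP ynz; apply: nex; exists y.
    apply: contraNneq ynz => /matrixP /(_ 0 0); rewrite !mxE => eq0; apply/eqP; rewrite -[RHS]eq0.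
    rewrite (reindex_onto (@enum_val I I) enum_rank) => [|j' _]; last exact: enum_rankK.
    rewrite (eq_bigl xpredT) => [|j']; last by rewrite /= enum_valK eqxx.
    by apply: eq_bigr => k _; rewrite !mxE /= enum_valK mulrC.
  rewrite -addn1; exists (fun i => if split i is inl i' then x i' else y).
  have -> : \matrix_(i < r + 1) rw (if split i is inl i' then x i' else y) = col_mx M (rw y).
    apply/row_matrixP => i; rewrite rowK; case: (split_ordP i) => i' ->.
      by rewrite rowKu rowK.
    by rewrite rowKd; apply/rowP => k; rewrite !mxE.
  apply: inj_row_free => v; rewrite -[v]hsubmxK mul_row_col => eqv.
  have v2 : rsubmx v = 0.
    have Ma : M *m col j (cokermx M) = 0 by rewrite colE mulmxA mulmx_coker mul0mx.
    have := congr1 (mulmx^~ (col j (cokermx M))) eqv.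
    rewrite /= mul0mx mulmxDl -!mulmxA Ma mulmx0 add0r.
    rewrite [rw y *m _]mx11_scalar mul_mx_scalar => /eqP.
    rewrite scaler_eq0 => /orP[/eqP c0|/eqP//].
    by case/eqP: ynz; rewrite [rw y *m _]mx11_scalar c0 raddf0.
  rewrite v2 mul0mx addr0 in eqv.
  have /eqP := eqv; rewrite mulmx_free_eq0 // => /eqP ->.
  by rewrite v2 row_mx0.
have [x] := ex_free n (leqnn n); set M := \matrix_i _; rewrite row_free_unit => unitM.
exists (fun i => x (enum_rank i)), (fun i k => invmx M (enum_rank i) (enum_rank k)).
have re (F : I -> K) : \sum_i F i = \sum_(k < n) F (enum_val k).
  rewrite (reindex_onto (@enum_val I I) enum_rank) => [|j' _]; last exact: enum_rankK.
  by rewrite (eq_bigl xpredT) => [|j']; last by rewrite /= enum_valK eqxx.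
have er i k : (enum_rank i == enum_rank k) = (i == k) by rewrite (inj_eq enum_rank_inj).
split=> i k; rewrite -er re.
  have /matrixP/(_ (enum_rank i) (enum_rank k)) := mulVmx unitM; rewrite !mxE => <-.
  by apply: eq_bigr => l _; rewrite !mxE !enum_valK enum_rankK.
have /matrixP/(_ (enum_rank i) (enum_rank k)) := mulmxV unitM; rewrite !mxE => <-.
by apply: eq_bigr => l _; rewrite !mxE !enum_valK.
Qed.

(** The inverse matrix over [K] also solves the system in the noncommutative ring [h]. This is the
    linear disjointness behind the faithfulness of the approximation. *)
Lemma independent_scalar_extension (K : fieldType) (X : Type) (I : finType) (w : X -> I -> K)
    (h : nzRingType) (kappa : {rmorphism K -> h}) (v : I -> h) :
  (forall a : I -> K, (forall x, \sum_i a i * w x i = 0) -> forall i, a i = 0) ->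
  (forall x, \sum_i v i * kappa (w x i) = 0) -> forall i, v i = 0.
Proof.
move=> /dual_family[x [B [Bw _]]] rel k.
have -> : v k = \sum_i v i * kappa (\sum_l B k l * w (x l) i).
  rewrite (bigD1 k) //= Bw eqxx rmorph1 mulr1 big1 ?addr0 // => i ne.
  by rewrite Bw eq_sym (negPf ne) rmorph0 mulr0.
under eq_bigr do rewrite rmorph_sum mulr_sumr.
rewrite exchange_big big1 //= => l _.
under eq_bigr do rewrite (mulrC (B k l)) rmorphM mulrA.
by rewrite -mulr_suml rel mul0r.
Qed.

Section GaloisBasis.
Variables (F L : fieldType) (j : {rmorphism F -> L}) (gT : finGroupType) (G : {group gT}).
Variable f : gT -> L -> L.
Hypothesis galL : galois_ext (fun _ : L => True) (fun x => exists r, x = j r).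
Hypothesis fG : forall g, g \in G -> in_Gal (fun _ : L => True) (fun x => exists r, x = j r) (f g).
Hypothesis fM : forall g1 g2, g1 \in G -> g2 \in G ->
  forall x, True -> f (g1 * g2)%g x = f g1 (f g2 x).
Hypothesis f_inj : forall g1 g2, g1 \in G -> g2 \in G ->
  (forall x, True -> f g1 x = f g2 x) -> g1 = g2.
Hypothesis f_all : forall s, in_Gal (fun _ : L => True) (fun x => exists r, x = j r) s ->
  exists2 g, g \in G & forall x, True -> s x = f g x.

Let gr (i : 'I_#|G|) : gT := enum_val i.
Let grG i : gr i \in G. Proof. exact: enum_valP. Qed.

Lemma field_subdivring : subdivring (fun _ : L => True).
Proof. by []. Qed.

Lemma field_is_divring : is_divring L.
Proof. by move=> x; rewrite unitfE. Qed.

(** By Dedekind independence the vectors of conjugates span [L^G], so some square matrix of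
    conjugates is invertible; its elements [e] will be the basis of [L] over [F]. *)
Lemma galois_action_dual_basis : exists (e : 'I_#|G| -> L) (B : 'I_#|G| -> 'I_#|G| -> L),
  (forall i k, \sum_l B i l * f (gr k) (e l) = (i == k)%:R) /\
  (forall i k, \sum_l f (gr l) (e i) * B l k = (i == k)%:R).
Proof.
apply: (@dual_family L L _ (fun x i => f (gr i) x)) => a rel.
apply: (@dedekind_independence L (fun=> True) _ (fun i => f (gr i)) a) => //.
- exact: field_is_divring.
- by move=> i; case: (fG (grG i)) => /aut1.
- by move=> i x y _ _; case: (fG (grG i)) => /autM ->.
- move=> i k v _ nzv comm; apply: enum_val_inj; apply: f_inj => // x _.
  by apply: (mulIf nzv); rewrite comm // mulrC.
by move=> x _; rewrite -[RHS](rel x); apply: eq_bigr => i _; rewrite mulrC.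
Qed.

(** Inverting the matrix of conjugates gives unique coordinates in [L]; uniqueness makes them
    [G]-invariant, and [galL] puts them in [F]. *)
Lemma galois_basis_coordinates (e : 'I_#|G| -> L) (B : 'I_#|G| -> 'I_#|G| -> L) :
  (forall i k, \sum_l B i l * f (gr k) (e l) = (i == k)%:R) ->
  (forall i k, \sum_l f (gr l) (e i) * B l k = (i == k)%:R) ->
  exists co : L -> 'I_#|G| -> F,
    (forall x, x = \sum_l j (co x l) * e l) /\
    (forall a l, co (\sum_l j (a l) * e l) l = a l).
Proof.
move=> Be eB.
pose c x l := \sum_k f (gr k) x * B k l.
have sum_autk k (E : 'I_#|G| -> L) : f (gr k) (\sum_l E l) = \sum_l f (gr k) (E l).
  by case: (fG (grG k)) => sG _; apply: (aut_sum field_subdivring sG).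
have c_uniq x a : (forall k, f (gr k) x = \sum_l a l * f (gr k) (e l)) ->
    forall l, c x l = a l.
  move=> ea l; rewrite /c; under eq_bigr do rewrite ea mulr_suml.
  rewrite exchange_big /= -[RHS](sum_mul_delta a); apply: eq_bigr => i _.
  by rewrite -eB mulr_sumr; apply: eq_bigr => k _; rewrite mulrA.
have cE x k : f (gr k) x = \sum_l c x l * f (gr k) (e l).
  rewrite /c; under eq_bigr do rewrite mulr_suml.
  rewrite exchange_big /= -[LHS](sum_mul_delta (fun i => f (gr i) x)); apply: eq_bigr => i _.
  by rewrite -Be mulr_sumr; apply: eq_bigr => l _; rewrite mulrA.
have f1 x : f 1%g x = x.
  case: (fG (group1 G)) => sG _; apply: (aut_inj sG) => //.
  by rewrite -fM ?group1 // mulg1.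
have cF x l : exists r, c x l = j r.
  apply: galL => // s /f_all[g gG sE]; rewrite sE //.
  (* [f g] permutes the equations that determine [c x], so the conjugated coordinates solve the same
     system. *)
  symmetry; apply: (c_uniq x (fun l => f g (c x l))) => k.
  have gk : (g^-1 * gr k)%g \in G by rewrite groupM ?groupV.
  have [k' k'E] : exists k', gr k' = (g^-1 * gr k)%g.
    by exists (enum_rank_in gk (g^-1 * gr k)%g); rewrite /gr enum_rankK_in.
  have fk y : f (gr k) y = f g (f (gr k') y).
    by rewrite -fM // k'E mulKVg.
  case: (fG gG) => sG _.
  rewrite fk [in LHS]cE (aut_sum field_subdivring sG) //.
  by apply: eq_bigr => i _; rewrite (autM sG) // -fk.
have [co coE] := choice (fun xl : L * 'I_#|G| => cF xl.1 xl.2).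
have e1 : exists k1, gr k1 = 1%g.
  by exists (enum_rank_in (group1 G) 1%g); rewrite /gr enum_rankK_in.
exists (fun x l => co (x, l)); split=> [x|a l].
  have [k1 k1E] := e1; have := cE x k1; rewrite k1E f1 => {1}->.
  by apply: eq_bigr => l _; rewrite f1 -coE.
apply: (fmorph_inj j); rewrite -coE; apply: (c_uniq _ (fun i => j (a i))) => k.
rewrite sum_autk; apply: eq_bigr => i _; case: (fG (grG k)) => sG fx.
by rewrite (autM sG) // fx //; exists (a i).
Qed.

End GaloisBasis.

(** * Extension of scalars along a central subfield *)

(** Finiteness of [L] over [F] enters through a basis with unique coordinates; [bc_central] is what
    lets the tensor product carry a multiplication. *)
Record base_change (F L : fieldType) (H : nzRingType) := BaseChange {
  bc_j : {rmorphism F -> L};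
  bc_gamma : {rmorphism F -> H};
  bc_central : forall a x, bc_gamma a * x = x * bc_gamma a;
  bc_dim : nat;
  bc_basis : 'I_bc_dim -> L;
  bc_coord : L -> 'I_bc_dim -> F;
  bc_coordK : forall x, x = \sum_l bc_j (bc_coord x l) * bc_basis l;
  bc_coord_uniq : forall a l, bc_coord (\sum_l bc_j (a l) * bc_basis l) l = a l }.

(* The ring [H (x)_F L], as the free left [H]-module on the given basis of [L]. *)
Definition tensor F L H (D : base_change F L H) := 'rV[H]_(bc_dim D).
HB.instance Definition _ F L H (D : base_change F L H) := GRing.Zmodule.on (tensor D).

Section Tensor.
Variables (F L : fieldType) (H : nzRingType) (D : base_change F L H).
Local Notation j := (bc_j D).
Local Notation gam := (bc_gamma D).
Local Notation e := (@bc_basis F L H D).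
Local Notation co := (@bc_coord F L H D).
Local Notation Tn := (tensor D).

(* The pure tensor [x (x) f]. *)
Definition tz (x : H) (f : L) : Tn := (\row_k (x * gam (co f k)) : 'rV[H]_(bc_dim D)).
Definition tcoord (x : Tn) k : H := (x : 'rV[H]_(bc_dim D)) 0 k.

Lemma tcoordP (x y : Tn) : (forall k, tcoord x k = tcoord y k) -> x = y.
Proof. by move=> xy; apply/rowP. Qed.

Lemma tcoord_tz x f k : tcoord (tz x f) k = x * gam (co f k).
Proof. by rewrite /tcoord mxE. Qed.

Lemma tcoordD x y k : tcoord (x + y) k = tcoord x k + tcoord y k.
Proof. by rewrite /tcoord mxE. Qed.

Lemma tcoord0 k : tcoord 0 k = 0.
Proof. by rewrite /tcoord mxE. Qed.

Lemma tcoord_sum (I : Type) (r : seq I) (P : pred I) (E : I -> Tn) k :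
  tcoord (\sum_(i <- r | P i) E i) k = \sum_(i <- r | P i) tcoord (E i) k.
Proof.
by elim/big_rec2: _ => [|i a b _ <-]; rewrite ?tcoord0 ?tcoordD.
Qed.

Lemma coordD x y k : co (x + y) k = co x k + co y k.
Proof.
rewrite [in LHS](bc_coordK D x) [in LHS](bc_coordK D y) -big_split /=.
under eq_bigr do rewrite -mulrDl -rmorphD.
exact: bc_coord_uniq.
Qed.

Lemma coordZ a x k : co (j a * x) k = a * co x k.
Proof.
rewrite [in LHS](bc_coordK D x) mulr_sumr.
under eq_bigr do rewrite mulrA -rmorphM.
exact: bc_coord_uniq.
Qed.

Lemma coord_basis i k : co (e i) k = (i == k)%:R.
Proof.
have <- : \sum_l j (i == l)%:R * e l = e i.
  by rewrite -[RHS](sum_mul_delta e i); apply: eq_bigr => l _; rewrite rmorph_nat mulrC eq_sym.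
exact: bc_coord_uniq.
Qed.

Lemma tzDl x y f : tz (x + y) f = tz x f + tz y f.
Proof. by apply: tcoordP => k; rewrite tcoordD !tcoord_tz mulrDl. Qed.

Lemma tzDr x f g : tz x (f + g) = tz x f + tz x g.
Proof. by apply: tcoordP => k; rewrite tcoordD !tcoord_tz coordD rmorphD mulrDr. Qed.

Lemma tz0l f : tz 0 f = 0.
Proof. by apply: (addrI (tz 0 f)); rewrite -tzDl !addr0. Qed.

Lemma tz0r x : tz x 0 = 0.
Proof. by apply: (addrI (tz x 0)); rewrite -tzDr !addr0. Qed.

Lemma tz_sumr (I : Type) (r : seq I) (P : pred I) x (E : I -> L) :
  tz x (\sum_(i <- r | P i) E i) = \sum_(i <- r | P i) tz x (E i).
Proof. exact: (big_morph (tz x) (tzDr x) (tz0r x)). Qed.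

Lemma tz_scalar x a f : tz (x * gam a) f = tz x (j a * f).
Proof. by apply: tcoordP => k; rewrite !tcoord_tz coordZ rmorphM mulrA. Qed.

Lemma tensorE (x : Tn) : x = \sum_a tz (tcoord x a) (e a).
Proof.
apply: tcoordP => k; rewrite tcoord_sum -[LHS](sum_mul_delta (tcoord x) k).
by apply: eq_bigr => i _; rewrite tcoord_tz coord_basis rmorph_nat.
Qed.

Definition tmul (x y : Tn) : Tn :=
  \sum_a \sum_b tz (tcoord x a * tcoord y b) (e a * e b).

Lemma tmulDl : left_distributive tmul +%R.
Proof.
move=> x y z; rewrite /tmul -big_split; apply: eq_bigr => a _ /=.
by rewrite -big_split; apply: eq_bigr => b _ /=; rewrite -tzDl -mulrDl tcoordD.
Qed.

Lemma tmulDr : right_distributive tmul +%R.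
Proof.
move=> x y z; rewrite /tmul -big_split; apply: eq_bigr => a _ /=.
by rewrite -big_split; apply: eq_bigr => b _ /=; rewrite -tzDl -mulrDr tcoordD.
Qed.

(** Coordinates of [f] and [g] enter through central elements of [H], so they can be collected. The
    remaining ring axioms then reduce to pure tensors. *)
Lemma tmul_tz x f y g : tmul (tz x f) (tz y g) = tz (x * y) (f * g).
Proof.
rewrite [in RHS](bc_coordK D f) [in RHS](bc_coordK D g) mulr_suml tz_sumr.
apply: eq_bigr => a _; rewrite mulr_sumr tz_sumr; apply: eq_bigr => b _.
rewrite !tcoord_tz mulrA -[x * _ * y]mulrA bc_central mulrA -[_ * gam _ * gam _]mulrA -rmorphM.
by rewrite tz_scalar mulrACA -rmorphM.
Qed.

Lemma tmul0x x : tmul 0 x = 0.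
Proof. by apply: (addrI (tmul 0 x)); rewrite -tmulDl !addr0. Qed.
Lemma tmulx0 x : tmul x 0 = 0.
Proof. by apply: (addrI (tmul x 0)); rewrite -tmulDr !addr0. Qed.

Lemma tmul_suml (I : Type) (r : seq I) (P : pred I) (E : I -> Tn) y :
  tmul (\sum_(i <- r | P i) E i) y = \sum_(i <- r | P i) tmul (E i) y.
Proof. exact: (big_morph (tmul^~ y) (fun a b => tmulDl a b y) (tmul0x y)). Qed.
Lemma tmul_sumr (I : Type) (r : seq I) (P : pred I) x (E : I -> Tn) :
  tmul x (\sum_(i <- r | P i) E i) = \sum_(i <- r | P i) tmul x (E i).
Proof. exact: (big_morph (tmul x) (tmulDr x) (tmulx0 x)). Qed.

Lemma tmulA : associative tmul.
Proof.
move=> x y z; rewrite (tensorE x) (tensorE y) (tensorE z).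
rewrite !tmul_suml; apply: eq_bigr => a _.
rewrite [tmul (tz _ _) (\sum_b tz (tcoord y b) _)]tmul_sumr !tmul_suml tmul_sumr.
apply: eq_bigr => b _; rewrite !tmul_sumr; apply: eq_bigr => c _.
by rewrite !tmul_tz !mulrA.
Qed.

Lemma tmul1x : left_id (tz 1 1) tmul.
Proof.
move=> x; rewrite {1}(tensorE x) tmul_sumr [RHS]tensorE; apply: eq_bigr => a _.
by rewrite tmul_tz !mul1r.
Qed.

Lemma tmulx1 : right_id (tz 1 1) tmul.
Proof.
move=> x; rewrite {1}(tensorE x) tmul_suml [RHS]tensorE; apply: eq_bigr => a _.
by rewrite tmul_tz !mulr1.
Qed.

Lemma tz1_inj f g : tz 1 f = tz 1 g -> f = g.
Proof.
move=> fg; rewrite (bc_coordK D f) (bc_coordK D g); apply: eq_bigr => l _.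
congr (j _ * _); apply: (fmorph_inj gam).
by have := congr1 (tcoord^~ l) fg; rewrite /= !tcoord_tz !mul1r.
Qed.

Lemma tensor_nonzero1 : tz 1 1 != 0.
Proof. by apply/eqP; rewrite -(tz0r 1) => /tz1_inj/eqP; rewrite oner_eq0. Qed.

End Tensor.

HB.instance Definition _ F L H (D : base_change F L H) :=
  GRing.Zmodule_isNzRing.Build (tensor D)
    (@tmulA F L H D) (@tmul1x F L H D) (@tmulx1 F L H D) (@tmulDl F L H D) (@tmulDr F L H D)
    (@tensor_nonzero1 F L H D).

Section TensorUnits.
Variables (F L : fieldType) (H : nzRingType) (D : base_change F L H).
Local Notation Tn := (tensor D).

(** The ring is not yet known to be a division ring, so invertibility is decided and inverses are
    chosen classically, with the identity on non-units. *)
Definition tunit : pred Tn := fun x => `[< exists y : Tn, y * x = 1 /\ x * y = 1 >].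
Definition tinv (x : Tn) : Tn :=
  if pselect (exists y : Tn, y * x = 1 /\ x * y = 1) is left ex then projT1 (cid ex) else x.

Lemma tmulVr : {in tunit, left_inverse 1 tinv *%R}.
Proof.
by move=> x /asboolP ux; rewrite /tinv; case: pselect => // ex; case: (cid ex) => y [].
Qed.
Lemma tdivrr : {in tunit, right_inverse 1 tinv *%R}.
Proof.
by move=> x /asboolP ux; rewrite /tinv; case: pselect => // ex; case: (cid ex) => y [].
Qed.
Lemma tunitP (x y : Tn) : y * x = 1 /\ x * y = 1 -> tunit x.
Proof. by move=> xy; apply/asboolP; exists y. Qed.
Lemma tinv_out : {in [predC tunit], tinv =1 id}.
Proof.
by move=> x /negP ux; rewrite /tinv; case: pselect => // ex; case: ux; apply/asboolP.
Qed.
End TensorUnits.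

HB.instance Definition _ F L H (D : base_change F L H) :=
  GRing.NzRing_hasMulInverse.Build (tensor D)
    (@tmulVr F L H D) (@tdivrr F L H D) (@tunitP F L H D) (@tinv_out F L H D).

Section TensorTheory.
Variables (F L : fieldType) (H : nzRingType) (D : base_change F L H).
Local Notation Tn := (tensor D).

Lemma tzM x f y g : tz D x f * tz D y g = tz D (x * y) (f * g).
Proof. exact: tmul_tz. Qed.

Lemma tz11 : tz D 1 1 = 1. Proof. by []. Qed.

Definition tleft (x : H) : Tn := tz D x 1.
Definition tright (f : L) : Tn := tz D 1 f.

Lemma tleft_zmod : zmod_morphism tleft.
Proof.
by move=> x y; apply/eqP; rewrite eq_sym subr_eq /tleft -tzDl subrK.
Qed.
Lemma tleft_monoid : monoid_morphism tleft.
Proof. by split=> // x y; rewrite /tleft tzM mulr1. Qed.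
HB.instance Definition _ := GRing.isZmodMorphism.Build H Tn tleft tleft_zmod.
HB.instance Definition _ := GRing.isMonoidMorphism.Build H Tn tleft tleft_monoid.

Lemma tright_zmod : zmod_morphism tright.
Proof.
by move=> x y; apply/eqP; rewrite eq_sym subr_eq /tright -tzDr subrK.
Qed.
Lemma tright_monoid : monoid_morphism tright.
Proof. by split=> // x y; rewrite /tright tzM mulr1. Qed.
HB.instance Definition _ := GRing.isZmodMorphism.Build L Tn tright tright_zmod.
HB.instance Definition _ := GRing.isMonoidMorphism.Build L Tn tright tright_monoid.

Lemma tzE x f : tz D x f = tleft x * tright f.
Proof. by rewrite tzM mulr1 mul1r. Qed.

Lemma tright_central f (x : Tn) : tright f * x = x * tright f.
Proof.
rewrite (tensorE x) mulr_sumr mulr_suml; apply: eq_bigr => a _.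
by rewrite !tzM mul1r mulr1 mulrC.
Qed.

Lemma tright_base a : tright (bc_j D a) = tleft (bc_gamma D a).
Proof. by rewrite /tright /tleft -[bc_gamma D a]mul1r tz_scalar mulr1. Qed.

Lemma tensor_decomp (x : Tn) : x = \sum_a tleft (tcoord x a) * tright (bc_basis (b:=D) a).
Proof. by rewrite [LHS]tensorE; apply: eq_bigr => a _; rewrite tzE. Qed.

Lemma tcoordM (x y : Tn) k : tcoord (x * y) k =
  \sum_a \sum_b tcoord x a * tcoord y b *
     bc_gamma D (bc_coord (b:=D) (bc_basis (b:=D) a * bc_basis (b:=D) b) k).
Proof.
rewrite [x * y]/(tmul x y) /tmul tcoord_sum; apply: eq_bigr => a _.
by rewrite tcoord_sum; apply: eq_bigr => b _; rewrite tcoord_tz.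
Qed.

Lemma tcoord_left x (y : Tn) k : tcoord (tleft x * y) k = x * tcoord y k.
Proof.
rewrite {1}[y]tensorE mulr_sumr tcoord_sum -[in RHS](sum_mul_delta (tcoord y) k) mulr_sumr.
apply: eq_bigr => a _.
by rewrite tzM tcoord_tz mul1r coord_basis rmorph_nat mulrA.
Qed.

End TensorTheory.

(** * Galois theory of the tensor product *)

Section TensorGalois.
Variables (F L : fieldType) (H : unitRingType) (D : base_change F L H).
Variables (gT : finGroupType) (G : {group gT}) (f : gT -> L -> L).
Variables (gr : 'I_(bc_dim D) -> gT) (B : 'I_(bc_dim D) -> 'I_(bc_dim D) -> L).
Local Notation j := (bc_j D).
Local Notation e := (bc_basis (b := D)).
Local Notation Tn := (tensor D).
Local Notation tleft := (tleft D).
Local Notation tright := (tright D).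
Hypothesis dH : is_divring H.
Hypothesis galL : galois_ext (fun _ : L => True) (fun x => exists r, x = j r).
Hypothesis fG : forall g, g \in G -> in_Gal (fun _ : L => True) (fun x => exists r, x = j r) (f g).
Hypothesis fM : forall g1 g2, g1 \in G -> g2 \in G ->
  forall x, True -> f (g1 * g2)%g x = f g1 (f g2 x).
Hypothesis f_inj : forall g1 g2, g1 \in G -> g2 \in G ->
  (forall x, True -> f g1 x = f g2 x) -> g1 = g2.
Hypothesis f_all : forall s, in_Gal (fun _ : L => True) (fun x => exists r, x = j r) s ->
  exists2 g, g \in G & forall x, True -> s x = f g x.
Hypothesis grG : forall i, gr i \in G.
Hypothesis Be : forall i k, \sum_l B i l * f (gr k) (e l) = (i == k)%:R.
Hypothesis eB : forall i k, \sum_l f (gr l) (e i) * B l k = (i == k)%:R.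
Hypothesis dT : is_divring Tn.

(** This is [id (x) f g] written on the basis; for [g] in [G], [tact_tz] shows that it does not
    depend on the basis. *)
Definition tact (g : gT) (x : Tn) : Tn := \sum_a tz D (tcoord x a) (f g (e a)).

Lemma tactD g x y : tact g (x + y) = tact g x + tact g y.
Proof. by rewrite -big_split; apply: eq_bigr => a _ /=; rewrite tcoordD tzDl. Qed.

Lemma tact0 g : tact g 0 = 0.
Proof. by apply: (addrI (tact g 0)); rewrite -tactD !addr0. Qed.

Lemma tact_sum g (I : Type) (r : seq I) (P : pred I) (E : I -> Tn) :
  tact g (\sum_(i <- r | P i) E i) = \sum_(i <- r | P i) tact g (E i).
Proof. exact: (big_morph (tact g) (tactD g) (tact0 g)). Qed.

Lemma tact_tz g x y : g \in G -> tact g (tz D x y) = tz D x (f g y).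
Proof.
move=> /fG[sG fx]; rewrite [in RHS](bc_coordK D y) (aut_sum (field_subdivring L) sG) // tz_sumr.
apply: eq_bigr => a _; rewrite tcoord_tz tz_scalar (autM sG) // [f g (j _)]fx //.
by exists (bc_coord (b:=D) y a).
Qed.

Lemma tactM g x y : g \in G -> tact g (x * y) = tact g x * tact g y.
Proof.
move=> gG; rewrite [x]tensorE [y]tensorE mulr_suml !tact_sum mulr_suml.
apply: eq_bigr => a _; rewrite !mulr_sumr tact_sum; apply: eq_bigr => b _.
rewrite tzM !tact_tz // tzM; case: (fG gG) => sG _.
by rewrite (autM sG).
Qed.

Lemma tact_left g x : g \in G -> tact g (tleft x) = tleft x.
Proof. by move=> gG; rewrite tact_tz //; case: (fG gG) => /aut1-> _. Qed.

Lemma galois_action1 x : f 1%g x = x.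
Proof.
case: (fG (group1 G)) => sG _; apply: (aut_inj sG) => //.
by rewrite -fM ?group1 // mulg1.
Qed.

Lemma tact_comp g1 g2 x : g1 \in G -> g2 \in G ->
  tact (g1 * g2)%g x = tact g1 (tact g2 x).
Proof.
move=> g1G g2G; rewrite [x]tensorE !tact_sum; apply: eq_bigr => a _.
by rewrite !tact_tz ?groupM // fM.
Qed.

Lemma tact1 x : tact 1%g x = x.
Proof. by rewrite /tact; under eq_bigr do rewrite galois_action1; rewrite -tensorE. Qed.

Lemma tact_in_Gal g : g \in G ->
  in_Gal (fun _ : Tn => True) (fun x => exists a, x = tleft a) (tact g).
Proof.
move=> gG; have gV : (g^-1)%g \in G by rewrite groupV.
split; last by move=> x [a ->]; apply: tact_left.
split=> //.
- move=> x y _ _ exy; rewrite -[x]tact1 -[y]tact1 -(mulVg g).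
  by rewrite !tact_comp // exy.
- by move=> y _; exists (tact g^-1%g y); rewrite // -tact_comp // mulgV tact1.
- by move=> x y _ _; apply: tactD.
split; first by move=> x y _ _; apply: tactM.
by rewrite -[in LHS](rmorph1 tleft) tact_left // rmorph1.
Qed.

(* The right factor is central in the tensor product. *)
Lemma tensor_outer : outer_ext (fun _ : Tn => True) (fun x => exists a, x = tleft a).
Proof.
move=> u _ nzu comm x _; have Uu := dT nzu.
rewrite [x]tensor_decomp mulr_sumr mulr_suml; apply: eq_bigr => a _.
rewrite -!mulrA tright_central !mulrA comm //.
by exists (tcoord x a).
Qed.

(** Summing the conjugates of an invariant [x] against column [l] of [B] gives [x * b l] and also,
    by duality, coordinate [l] of [x]. Some [b l] is nonzero, so [x] is a pure tensor [y (x) c], and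
    invariance puts [c] in [F]. *)
Lemma tensor_galois : galois_ext (fun _ : Tn => True) (fun x => exists a, x = tleft a).
Proof.
move=> x _ fixx.
have xk g : g \in G -> tact g x = x by move=> /tact_in_Gal /fixx.
pose b l := \sum_k B k l.
have xb l : x * tright (b l) = tleft (tcoord x l).
  rewrite rmorph_sum mulr_sumr.
  under eq_bigr => k _ do rewrite -{1}(xk _ (grG k)) mulr_suml.
  rewrite exchange_big /= -[tcoord x l](sum_mul_delta (tcoord x)) rmorph_sum.
  apply: eq_bigr => a _; rewrite rmorphM rmorph_nat -(rmorph_nat tright) -eB rmorph_sum mulr_sumr.
  by apply: eq_bigr => k _; rewrite rmorphM tzE mulrA.
have [->|nzx] := eqVneq x 0; first by exists 0; rewrite rmorph0.
have [l nzb] : exists l, b l != 0.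
  apply: contrapT => allz.
  have [a _] : exists a : 'I_(bc_dim D), True.
    apply: contrapT => nob; case/eqP: nzx; rewrite (tensorE x) big1 // => a _.
    by case: nob; exists a.
  have : \sum_l b l * f (gr a) (e l) = 1.
    under eq_bigr do rewrite mulr_suml; rewrite exchange_big /=.
    under eq_bigr do rewrite Be -[(_ == _)%:R]mul1r.
    exact: (sum_mul_delta (fun=> 1)).
  rewrite big1 => [/esym/eqP|l _]; first by rewrite oner_eq0.
  have [->|nz] := eqVneq (b l) 0; first by rewrite mul0r.
  by case: allz; exists l.
set y := tcoord x l; set c := (b l)^-1.
have xE : x = tz D y c.
  by rewrite tzE -xb -mulrA -rmorphM mulfV // rmorph1 mulr1.
have nzy : y != 0 by apply: contraNneq nzx => y0; rewrite xE y0 tz0l.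
have [|r cE] := galL (x := c) I.
  move=> s /f_all[g gG ->] //; have := xk g gG; rewrite xE tact_tz // !tzE.
  move/(congr1 ( *%R (tleft y^-1))); rewrite !mulrA -rmorphM mulVr ?rmorph1 ?mul1r; last exact: dH.
  exact: tz1_inj.
by exists (y * bc_gamma D r); rewrite xE cE /tleft tz_scalar mulr1.
Qed.

(* On the central factor [L], [s] is a combination [sum_k c_k f_k] of the Galois conjugations, and
   multiplicativity forces [c_k (f_k - s) = 0]. *)
Lemma tensor_aut_exhaust s :
  in_Gal (fun _ : Tn => True) (fun x => exists a, x = tleft a) s ->
  exists2 g, g \in G & forall x, True -> s x = tact g x.
Proof.
move=> [sG sfix]; have sT : subdivring (fun _ : Tn => True) by [].
(* These coefficients solve the system [s (e m) = sum_k c_k f_k (e m)], whose matrix has inverse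
   [B]. *)
pose c k := \sum_l s (tright (e l)) * tright (B k l).
have sleft a : s (tleft a) = tleft a by apply: sfix; exists a.
have sE x : s (tright x) = \sum_k c k * tright (f (gr k) x).
  have sEe m : s (tright (e m)) = \sum_k c k * tright (f (gr k) (e m)).
    rewrite -[LHS](sum_mul_delta (fun l => s (tright (e l))) m) /c.
    under [RHS]eq_bigr do rewrite mulr_suml; rewrite [RHS]exchange_big /=; apply: eq_bigr => l _.
    rewrite -(rmorph_nat tright) eq_sym -eB rmorph_sum mulr_sumr; apply: eq_bigr => k _.
    by rewrite rmorphM tright_central mulrA.
  rewrite [in LHS](bc_coordK D x) rmorph_sum (aut_sum sT sG) //.
  have fE k : tright (f (gr k) x) =
      \sum_m tleft (bc_gamma D (bc_coord (b:=D) x m)) * tright (f (gr k) (e m)).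
    case: (fG (grG k)) => kG kfix.
    rewrite [in LHS](bc_coordK D x) (aut_sum (field_subdivring L) kG) // rmorph_sum.
    apply: eq_bigr => m _; rewrite (autM kG) // kfix; last by exists (bc_coord (b:=D) x m).
    by rewrite rmorphM -tright_base.
  under [RHS]eq_bigr do rewrite fE mulr_sumr.
  rewrite [RHS]exchange_big /=; apply: eq_bigr => m _.
  rewrite rmorphM (autM sG) // -tright_base.
  have -> : s (tright (j (bc_coord (b:=D) x m))) = tright (j (bc_coord (b:=D) x m)).
    by rewrite tright_base sleft.
  rewrite sEe mulr_sumr; apply: eq_bigr => k _; rewrite !mulrA.
  congr (_ * _); exact: tright_central.
(* [c k] combines elements of the commutative ring [s (tright L)] with central ones. *)
have commc k x : c k * s (tright x) = s (tright x) * c k.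
  rewrite mulr_suml mulr_sumr; apply: eq_bigr => l _.
  rewrite -mulrA tright_central !mulrA -!(autM sG) // -!rmorphM.
  by rewrite [e l * x]mulrC.
have key y k : c k * (tright (f (gr k) y) - s (tright y)) = 0.
  pose d k := c k * (tright (f (gr k) y) - s (tright y)).
  have rel x : \sum_k d k * tright (f (gr k) x) = 0.
    rewrite /d; under eq_bigr do rewrite mulrBr mulrBl.
    rewrite sumrB; apply/eqP; rewrite subr_eq0; apply/eqP.
    transitivity (s (tright (y * x))).
      rewrite sE; apply: eq_bigr => i _; case: (fG (grG i)) => iG _.
      by rewrite (autM iG) // rmorphM mulrA.
    rewrite rmorphM (autM sG) // [s (tright x)]sE mulr_sumr.
    by apply: eq_bigr => i _; rewrite mulrA commc.
  rewrite -/(d k) -(sum_mul_delta d k).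
  under eq_bigr => i _ do
    rewrite eq_sym -(rmorph_nat tright) -Be rmorph_sum mulr_sumr.
  rewrite exchange_big big1 //= => l _.
  under eq_bigr => i _ do rewrite rmorphM tright_central mulrA.
  by rewrite -mulr_suml rel mul0r.
have [k nzc] : exists k, c k != 0.
  apply: contrapT => allz.
  have : s (tright 1) = 0.
    rewrite sE big1 // => k _; have [->|nz] := eqVneq (c k) 0; first by rewrite mul0r.
    by case: allz; exists k.
  by rewrite rmorph1 (aut1 sG) => /eqP; rewrite oner_eq0.
exists (gr k) => // x _.
have sk y : s (tright y) = tright (f (gr k) y).
  apply/eqP; rewrite eq_sym -subr_eq0; apply/eqP.
  by apply: (mulrI (dT nzc)); rewrite key mulr0.
rewrite [in LHS](tensor_decomp x) (aut_sum sT sG) //; apply: eq_bigr => a _.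
by rewrite (autM sG) // sleft sk tzE.
Qed.

Lemma tensor_gal_group : gal_group_iso (fun _ : Tn => True) (fun x => exists a, x = tleft a) G.
Proof.
exists tact; split.
- exact: tact_in_Gal.
- by move=> g1 g2 g1G g2G x _; apply: tact_comp.
- move=> g1 g2 g1G g2G e12; apply: f_inj => // x _; apply: (@tz1_inj _ _ _ D).
  by rewrite -!tact_tz // e12.
- exact: tensor_aut_exhaust.
Qed.

End TensorGalois.

(** * Skew polynomials inside a division ring *)

Section SkewPolynomials.
Variables (h H : unitRingType) (A : h -> Prop) (sg : h -> h).
Variables (phi : {rmorphism h -> H}) (T : H).

Definition coefs_in (p : {poly h}) := forall i, A p`_i.
(** [{poly h}] only carries coefficients, placed to the left of the powers of [T]. Its product is
    untwisted, so [skew_eval] respects sums, left constants and right powers of ['X], but not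
    general products. *)
Definition skew_eval (p : {poly h}) : H := (map_poly phi p).[T].
(* The subring [A[T, sg]] of [H] and its ideal generated by [T ^+ N]. *)
Definition skew_poly (y : H) := exists2 p, coefs_in p & y = skew_eval p.
Definition skew_ideal N (y : H) := exists2 p, coefs_in p & y = skew_eval p * T ^+ N.
Definition skew_twist (p : {poly h}) : {poly h} := \poly_(i < size p) sg p`_i.

Local Notation ev := skew_eval.
Local Notation O := skew_poly.

Hypotheses (dh : is_divring h) (dH : is_divring H).
Hypotheses (sA : subdivring A) (autA : ring_aut_on A sg).
Hypothesis commT : forall a, A a -> T * phi a = phi (sg a) * T.
Hypothesis indT : forall (m : nat) (c : nat -> h), (forall i, A (c i)) ->
  \sum_(i < m) phi (c i) * T ^+ i = 0 -> forall i, (i < m)%N -> c i = 0.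

Lemma ev0 : ev 0 = 0. Proof. by rewrite /ev raddf0 horner0. Qed.
Lemma evD p q : ev (p + q) = ev p + ev q. Proof. by rewrite /ev raddfD hornerD. Qed.
Lemma evB p q : ev (p - q) = ev p - ev q. Proof. by rewrite /ev raddfB hornerD hornerN. Qed.
Lemma evC c : ev c%:P = phi c. Proof. by rewrite /ev map_polyC hornerC. Qed.
Lemma evMX p : ev (p * 'X) = ev p * T.
Proof. by rewrite /ev rmorphM /= map_polyX hornerMX. Qed.
Lemma evMXn p n : ev (p * 'X^n) = ev p * T ^+ n.
Proof. by elim: n => [|n IH]; rewrite ?mulr1 // !exprSr !mulrA evMX IH. Qed.
Lemma evCM c p : ev (c%:P * p) = phi c * ev p.
Proof. by rewrite /ev rmorphM /= map_polyC hornerCM. Qed.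
Lemma ev_sum (I : Type) (r : seq I) (P : pred I) (E : I -> {poly h}) :
  ev (\sum_(i <- r | P i) E i) = \sum_(i <- r | P i) ev (E i).
Proof. exact: (big_morph ev evD ev0). Qed.
Lemma ev_wide n (p : {poly h}) : (size p <= n)%N -> ev p = \sum_(i < n) phi p`_i * T ^+ i.
Proof.
move=> sp; rewrite /ev (@horner_coef_wide _ n); last exact: leq_trans (size_poly _ _) sp.
by apply: eq_bigr => i _; rewrite coef_map.
Qed.

Lemma ev_eq0 p : coefs_in p -> ev p = 0 -> p = 0.
Proof.
move=> Ap; rewrite (ev_wide (leqnn _)) => /indT p0; apply/polyP => i; rewrite coef0.
have [lt|ge] := ltnP i (size p); last by rewrite nth_default.
by apply: p0 => // k; apply: Ap.
Qed.

Lemma ev_inj p q : coefs_in p -> coefs_in q -> ev p = ev q -> p = q.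
Proof.
move=> Ap Aq epq; apply/eqP; rewrite -subr_eq0; apply/eqP; apply: ev_eq0.
  by move=> i; rewrite coefB; apply: (subdivringB sA).
by rewrite evB epq subrr.
Qed.

Lemma coefs_in0 : coefs_in 0. Proof. by move=> i; rewrite coef0; apply: (subdivring0 sA). Qed.
Lemma coefs_inC c : A c -> coefs_in c%:P.
Proof. by move=> Ac i; rewrite coefC; case: ifP => // _; apply: (subdivring0 sA). Qed.
Lemma coefs_inD p q : coefs_in p -> coefs_in q -> coefs_in (p + q).
Proof. by move=> Ap Aq i; rewrite coefD; apply: (subdivringD sA). Qed.
Lemma coefs_inB p q : coefs_in p -> coefs_in q -> coefs_in (p - q).
Proof. by move=> Ap Aq i; rewrite coefB; apply: (subdivringB sA). Qed.
Lemma coefs_inM p q : coefs_in p -> coefs_in q -> coefs_in (p * q).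
Proof.
move=> Ap Aq i; rewrite coefM; apply: (subdivring_sum sA) => k.
exact: (subdivringM sA).
Qed.
Lemma coefs_inX : coefs_in 'X.
Proof.
by move=> i; rewrite coefX; case: eqP => _; [apply: (subdivring1 sA) | apply: (subdivring0 sA)].
Qed.
Lemma coefs_inXn n : coefs_in 'X^n.
Proof.
elim: n => [|n IH]; last by rewrite exprS; apply: coefs_inM => //; apply: coefs_inX.
exact/coefs_inC/(subdivring1 sA).
Qed.
Lemma coefs_in_sum (I : Type) (r : seq I) (P : pred I) (E : I -> {poly h}) :
  (forall i, coefs_in (E i)) -> coefs_in (\sum_(i <- r | P i) E i).
Proof.
by move=> AE; apply: (big_ind coefs_in) => //; [apply: coefs_in0 | apply: coefs_inD].
Qed.

Lemma coefs_in_ind (P : {poly h} -> Prop) :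
  P 0 -> (forall p c, coefs_in p -> A c -> P p -> P (p * 'X + c%:P)) ->
  forall p, coefs_in p -> P p.
Proof.
move=> P0 PS; elim/poly_ind => // p c IH Apc.
have Ap : coefs_in p by move=> i; have := Apc i.+1; rewrite coefD coefMX coefC /= addr0.
have Ac : A c by have := Apc 0%N; rewrite coefD coefMX coefC /= add0r.
exact: PS (IH Ap).
Qed.

Lemma skew_T_neq0 : T != 0.
Proof.
apply/eqP => T0.
have := @indT 2 (fun i => (i == 1%N)%:R) _ _ 1%N isT.
rewrite big_ord_recl big_ord1 /= T0 rmorph0 mul0r expr1 mulr0 addr0 => /(_ _ erefl) H1.
have /H1/eqP : forall i, A (i == 1)%N%:R.
  by move=> [|[|i]] /=; [apply: (subdivring0 sA)|apply: (subdivring1 sA)|apply: (subdivring0 sA)].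
by rewrite oner_eq0.
Qed.

Lemma skew_T_unit : T \is a GRing.unit. Proof. exact: dH skew_T_neq0. Qed.

Lemma coef_skew_twist p i : (skew_twist p)`_i = sg p`_i.
Proof.
rewrite coef_poly; case: ltnP => // ge.
by rewrite nth_default // (aut0 sA autA).
Qed.

Lemma coefs_in_twist m p : coefs_in p -> coefs_in (iter m skew_twist p).
Proof.
move=> Ap; elim: m => //= m IH i; rewrite coef_skew_twist; apply: (aut_stable autA); exact: IH.
Qed.

Lemma size_skew_twist m (p : {poly h}) : (size (iter m skew_twist p) <= size p)%N.
Proof. by elim: m => //= m; apply: leq_trans (size_poly _ _). Qed.

Lemma coef_iter_twist m p i : (iter m skew_twist p)`_i = iter m sg p`_i.
Proof. by elim: m => //= m <-; rewrite coef_skew_twist. Qed.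

Lemma skew_twistP m p : coefs_in p -> T ^+ m * ev p = ev (iter m skew_twist p) * T ^+ m.
Proof.
have one q : coefs_in q -> T * ev q = ev (skew_twist q) * T.
  move=> Aq; rewrite (ev_wide (leqnn _)) (ev_wide (size_poly _ _)) mulr_sumr mulr_suml.
  apply: eq_bigr => i _; rewrite coef_skew_twist mulrA commT // -!mulrA.
  by rewrite -exprS -exprSr.
move=> Ap; elim: m => [|m IH]; first by rewrite mul1r mulr1.
rewrite exprS -mulrA IH mulrA one; last exact: coefs_in_twist.
by rewrite -mulrA -exprS.
Qed.

(** The constant coefficient is multiplicative without twist, which is what additivity of the
    [T]-adic order rests on. The induction is general in [q] because moving [T] across [q] twists
    it. *)
Lemma skew_evalM p q : coefs_in p -> coefs_in q ->
  exists r, [/\ coefs_in r, ev p * ev q = ev r & r`_0 = p`_0 * q`_0].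
Proof.
move=> Ap; elim/coefs_in_ind: p / Ap q => [|p c Ap Ac IH] q Aq.
  by exists 0; split; [apply: coefs_in0 | rewrite ev0 mul0r | rewrite !coef0 mul0r].
have [r [Ar er _]] := IH _ (coefs_in_twist 1 Aq).
exists (r * 'X + c%:P * q); split.
- apply: coefs_inD; apply: coefs_inM => //; [exact: coefs_inX | exact: coefs_inC].
- rewrite !evD !evMX evC evCM mulrDl -er -!mulrA; congr (_ * _ + _).
  by have := skew_twistP 1 Aq; rewrite expr1.
- by rewrite !coefD !coefMX coefC coefCM /= !add0r.
Qed.

Lemma skew_poly0 : O 0. Proof. by exists 0; [apply: coefs_in0 | rewrite ev0]. Qed.
Lemma skew_poly_phi c : A c -> O (phi c).
Proof. by move=> Ac; exists c%:P; [apply: coefs_inC | rewrite evC]. Qed.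
Lemma skew_poly1 : O 1.
Proof. by rewrite -(rmorph1 phi); apply/skew_poly_phi/(subdivring1 sA). Qed.
Lemma skew_polyT : O T.
Proof.
exists 'X; first exact: coefs_inX.
by rewrite -['X]mul1r evMX -[1]/(1%:P) evC rmorph1 mul1r.
Qed.
Lemma skew_polyD x y : O x -> O y -> O (x + y).
Proof. by move=> [p Ap ->] [q Aq ->]; exists (p + q); [apply: coefs_inD | rewrite evD]. Qed.
Lemma skew_polyB x y : O x -> O y -> O (x - y).
Proof. by move=> [p Ap ->] [q Aq ->]; exists (p - q); [apply: coefs_inB | rewrite evB]. Qed.
Lemma skew_polyM x y : O x -> O y -> O (x * y).
Proof. by move=> [p Ap ->] [q Aq ->]; have [r [Ar -> _]] := skew_evalM Ap Aq; exists r. Qed.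
Lemma skew_polyX x n : O x -> O (x ^+ n).
Proof.
move=> Ox; elim: n => [|n IH]; first exact: skew_poly1.
by rewrite exprS; apply: skew_polyM.
Qed.
Lemma skew_poly_sum (I : Type) (r : seq I) (P : pred I) (E : I -> H) :
  (forall i, O (E i)) -> O (\sum_(i <- r | P i) E i).
Proof.
by move=> OE; apply: (big_ind O) => //; [apply: skew_poly0 | apply: skew_polyD].
Qed.

Lemma skew_idealP N y : skew_ideal N y <-> exists2 z, O z & y = z * T ^+ N.
Proof.
split=> [[p Ap ->]|[z [p Ap ->] ->]]; last by exists p.
by exists (ev p) => //; exists p.
Qed.
Lemma skew_ideal_0 N : skew_ideal N 0.
Proof. by exists 0; [apply: coefs_in0 | rewrite ev0 mul0r]. Qed.
Lemma skew_idealD N x y : skew_ideal N x -> skew_ideal N y -> skew_ideal N (x + y).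
Proof.
by move=> [p Ap ->] [q Aq ->]; exists (p + q); [apply: coefs_inD | rewrite evD mulrDl].
Qed.
Lemma skew_idealB N x y : skew_ideal N x -> skew_ideal N y -> skew_ideal N (x - y).
Proof.
by move=> [p Ap ->] [q Aq ->]; exists (p - q); [apply: coefs_inB | rewrite evB mulrBl].
Qed.
Lemma skew_ideal_sum N (I : Type) (r : seq I) (P : pred I) (E : I -> H) :
  (forall i, skew_ideal N (E i)) -> skew_ideal N (\sum_(i <- r | P i) E i).
Proof.
by move=> OE; apply: (big_ind (skew_ideal N)) => //; [apply: skew_ideal_0 | apply: skew_idealD].
Qed.
Lemma skew_idealMl N x y : O x -> skew_ideal N y -> skew_ideal N (x * y).
Proof.
move=> Ox /skew_idealP[z Oz ->]; apply/skew_idealP; exists (x * z); rewrite ?mulrA //.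
exact: skew_polyM.
Qed.
Lemma skew_ideal_le N M x : (N <= M)%N -> skew_ideal M x -> skew_ideal N x.
Proof.
move=> le [p Ap ->]; exists (p * 'X^(M - N)); last by rewrite evMXn -mulrA -exprD subnK.
by apply: coefs_inM => //; apply: coefs_inXn.
Qed.

Lemma skew_ideal_coef N p m : coefs_in p -> skew_ideal N (ev p) -> (m < N)%N -> p`_m = 0.
Proof.
move=> Ap [q Aq]; rewrite -evMXn => /ev_inj -> //; first by rewrite coefMXn => ->.
by apply: coefs_inM => //; apply: coefs_inXn.
Qed.

Lemma skew_lowest_term N p : coefs_in p -> ~ skew_ideal N (ev p) ->
  exists i q, [/\ (i < N)%N, coefs_in q, q`_0 != 0 & ev p = ev q * T ^+ i].
Proof.
elim: N p => [|N IH] p Ap; first by case; exists p => //; rewrite mulr1.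
elim/coefs_in_ind: p / Ap => [|p c Ap Ac _]; first by case; rewrite ev0; apply: skew_ideal_0.
have [->|nzc] := eqVneq c 0; last first.
  move=> _; exists 0%N, (p * 'X + c%:P); split=> //; last by rewrite mulr1.
    by apply: coefs_inD; [apply: coefs_inM => //; apply: coefs_inX | apply: coefs_inC].
  by rewrite coefD coefMX coefC /= add0r.
rewrite addr0 evMX => nI; have [|i [q [lt Aq nz e]]] := IH p Ap.
  by move=> [r Ar e]; apply: nI; exists r => //; rewrite e -mulrA -exprSr.
by exists i.+1, q; split=> //; rewrite e -mulrA -exprSr.
Qed.

(** Lowest terms multiply: for [x = p' T^i] and [y = q' T^j], the coefficient of [T^(i+j)] in
    [x * y] is [p'_0] times the [i]-th twist of [q'_0], which is nonzero since [sg] is injective on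
    [A]. *)
Lemma skew_ideal_prime N M x y : O x -> O y ->
  ~ skew_ideal N x -> ~ skew_ideal M y -> ~ skew_ideal (N + M) (x * y).
Proof.
move=> [p Ap ->] [q Aq ->] /(skew_lowest_term Ap)[i [p' [iN Ap' nzp ->]]].
move=> /(skew_lowest_term Aq)[j [q' [jM Aq' nzq ->]]] [r Ar].
rewrite -mulrA [T ^+ i * _]mulrA skew_twistP // -mulrA -exprD mulrA.
have [r' [Ar' -> r'0]] := skew_evalM Ap' (coefs_in_twist i Aq').
have lt : (i + j < N + M)%N by rewrite -addSn leq_add // ltnW.
rewrite -(subnK (ltnW lt)) [T ^+ (_ - _ + _)]exprD mulrA.
move/(mulIr (unitrX _ skew_T_unit)); rewrite -evMXn.
move/ev_inj => /(_ Ar' (coefs_inM Ar (coefs_inXn _)))/(congr1 (fun p : {poly h} => p`_0)).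
rewrite r'0 coefMXn subn_gt0 lt coef_iter_twist => /eqP; apply/negP.
apply: (divring_mulf_neq0 dh) => //; apply: contraNneq nzq => e0.
apply/eqP; apply: (aut_iter_inj autA (m := i)); rewrite ?e0 //.
  exact: (subdivring0 sA).
by elim: (i) => //= m <-; rewrite (aut0 sA autA).
Qed.

(* A dimension count: [T^i x] and [T^i y] with [i < N] are [2N] vectors in a space of
   dimension [N + deg + 1]. *)
Lemma skew_ore x y : O x -> O y -> y != 0 ->
  exists c e, [/\ O c, O e, c != 0 & c * x = e * y].
Proof.
move=> [p Ap ->] [q Aq ->] nzy.
(* Multiplication by [T^i] with [i < N] keeps sizes within [D + N], and [N = D + 1] makes [2N]
   exceed this. *)
pose D := maxn (size p) (size q); pose N := D.+1.
pose P (k : 'I_N + 'I_N) : {poly h} :=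
  match k with inl i => iter i skew_twist p * 'X^i | inr i => iter i skew_twist q * 'X^i end.
have AP k : coefs_in (P k).
  by case: k => i; apply: coefs_inM; first [exact: coefs_in_twist | exact: coefs_inXn].
have sP k : (size (P k) <= D + N)%N.
  have aux (r : {poly h}) (i : 'I_N) : (size r <= D)%N ->
      (size (iter i skew_twist r * 'X^i)%R <= D + N)%N.
    move=> sr; apply: leq_trans (size_polyMleq _ _) _; rewrite size_polyXn addnS /=.
    by rewrite leq_add // ?(leq_trans (size_skew_twist _ _)) // ltnW.
  by case: k => i; apply: aux; rewrite ?leq_maxl ?leq_maxr.
have [r k||c [Ac [k0 nz] rel]] :=
  @left_dependence h A 'I_(D + N) ('I_N + 'I_N)%type (fun r k => (P k)`_r) dh sA.
- exact: AP.
- by rewrite card_sum !card_ord /N addSn addnS ltnS.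
pose C (s : 'I_N -> 'I_N + 'I_N) : {poly h} := \poly_(i < N) c (s (inord i)).
have AC s : coefs_in (C s).
  by move=> i; rewrite coef_poly; case: ifP => // _; apply: (subdivring0 sA).
have evCs s : ev (C s) = \sum_(i < N) phi (c (s i)) * T ^+ i.
  rewrite (ev_wide (size_poly _ _)); apply: eq_bigr => i _.
  by rewrite coef_poly ltn_ord inord_val.
have total : ev (C inl) * ev p + ev (C inr) * ev q = 0.
  have sum0 : \sum_k (c k)%:P * P k = 0.
    apply/polyP => r; rewrite coef_sum coef0.
    have [lt|ge] := ltnP r (D + N)%N.
      by rewrite -[RHS](rel (Ordinal lt)); apply: eq_bigr => k _; rewrite coefCM.
    by rewrite big1 // => k _; rewrite coefCM nth_default ?mulr0 // (leq_trans (sP k)).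
  rewrite -ev0 -sum0 ev_sum big_sumType /= !evCs !mulr_suml.
  by congr (_ + _); apply: eq_bigr => i _; rewrite evCM evMXn -skew_twistP // mulrA.
exists (ev (C inl)), (- ev (C inr)); split.
- by exists (C inl).
- by rewrite -sub0r; apply: skew_polyB; [apply: skew_poly0 | exists (C inr)].
(* If [c] were 0, then [e * y = 0] would force [e = 0], and every coefficient of the dependence
   would vanish. *)
- apply/eqP => c0; move: total; rewrite c0 mul0r add0r => /eqP; apply/negP.
  apply: (divring_mulf_neq0 dH) => //; apply/eqP => e0.
  have Cz s : ev (C s) = 0 -> forall i : 'I_N, c (s i) = 0.
    move=> /(ev_eq0 (AC s)) /polyP Cs0 i; have := Cs0 i.
    by rewrite coef_poly ltn_ord inord_val coef0.
  by case/eqP: nz; case: k0 => i; apply: Cz.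
- by apply/eqP; rewrite mulNr -addr_eq0 total.
Qed.

Definition skew_frac x := exists a, [/\ O a, a != 0 & O (a * x)].

(** Ore localization: common left multiples give common denominators for differences, and for
    [x * y] they move the denominator of [y] past the numerator of [x]. *)
Lemma skew_frac_subdivring : subdivring skew_frac.
Proof.
split.
- exists 1; rewrite mulr0 oner_neq0; split; [exact: skew_poly1| by [] | exact: skew_poly0].
- exists 1; rewrite mulr1 oner_neq0; split; [exact: skew_poly1| by [] | exact: skew_poly1].
- move=> x y [a [Oa nza Oax]] [b [Ob nzb Oby]].
  have [c [e [Oc Oe nzc ce]]] := skew_ore Oa Ob nzb.
  exists (c * a); split; [exact: skew_polyM | exact: divring_mulf_neq0 | ].
  by rewrite mulrBr {2}ce -!mulrA; apply: skew_polyB; apply: skew_polyM.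
- move=> x y [a [Oa nza Oax]] [b [Ob nzb Oby]].
  have [c [e [Oc Oe nzc ce]]] := skew_ore Oax Ob nzb.
  exists (c * a); split; [exact: skew_polyM | exact: divring_mulf_neq0 | ].
  by rewrite mulrA -[c * a * x]mulrA ce -mulrA; apply: skew_polyM.
- move=> x [a [Oa nza Oax]]; have [->|nzx] := eqVneq x 0.
    rewrite invr0; exists 1; rewrite mulr0 oner_neq0.
    by split; [exact: skew_poly1 | by [] | exact: skew_poly0].
  exists (a * x); split=> //; first exact: divring_mulf_neq0.
  by rewrite mulrK //; apply: dH.
Qed.

Lemma gen_skew_frac x :
  gen_divring (fun y => y = T \/ exists a, A a /\ y = phi a) x -> skew_frac x.
Proof.
move=> /(_ skew_frac skew_frac_subdivring); apply.
move=> y yE; exists 1; rewrite mul1r oner_neq0; split=> //; first exact: skew_poly1.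
by case: yE => [->|[a [Aa ->]]]; [exact: skew_polyT | exact: skew_poly_phi].
Qed.

Lemma common_denominator n (x : 'I_n -> H) : (forall i, skew_frac (x i)) ->
  exists a, [/\ O a, a != 0 & forall i, O (a * x i)].
Proof.
elim: n x => [|n IH] x fx.
  by exists 1; rewrite oner_neq0; split=> [|//|[]//]; apply: skew_poly1.
have [i|a [Oa nza Oax]] := IH (fun i => x (lift ord0 i)); first exact: fx.
have [b [Ob nzb Obx]] := fx ord0.
have [c [e [Oc Oe nzc ce]]] := skew_ore Oa Ob nzb.
exists (c * a); split; [exact: skew_polyM | exact: divring_mulf_neq0 | ].
move=> i; have [i' ->|->] := unliftP ord0 i; last by rewrite ce -mulrA; apply: skew_polyM.
by rewrite -mulrA; apply: skew_polyM.
Qed.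

End SkewPolynomials.

(** * Truncated Laurent series *)

Lemma fracP (R : idomainType) (c : {fraction R}) :
  exists p q, q != 0 /\ tofrac q * c = tofrac p.
Proof.
elim/quotW: c => x; exists (\n_x), (\d_x); split; first exact: denom_ratioP.
apply/eqP; unlock FracField.tofrac; rewrite -[X in X == _]FracField.pi_mul.
by rewrite FracField.equivf_def /FracField.mulf !numden_Ratio
  ?(mul1r, mulr1, oner_neq0, denom_ratioP) // mulrC.
Qed.

Lemma frac_common_denominator (R : idomainType) (I : finType) (c : I -> {fraction R}) :
  exists2 q, q != 0 & forall i, exists p, tofrac q * c i = tofrac p.
Proof.
have [q qP] := choice (fun i => let: ex_intro p H := fracP (c i) in
  let: ex_intro q (conj nz e) := H in
  ex_intro (fun q => q != 0 /\ exists p, tofrac q * c i = tofrac p) q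
    (conj nz (ex_intro _ p e))).
exists (\prod_i q i); first by apply/prodf_neq0 => i _; case: (qP i).
move=> i; have [_ [p e]] := qP i; rewrite (bigD1 i) //=.
by exists (\prod_(k | k != i) q k * p); rewrite !rmorphM /= -e mulrA; congr (_ * _); apply: mulrC.
Qed.

Section LaurentTruncation.
Variables (K L : fieldType) (j : {rmorphism {fraction {poly K}} -> L}).
Variable iota : L -> int -> K.
Hypothesis iota_valid : forall x, laurent_valid (iota x).
Hypothesis iota_inj : forall x y, (forall n, iota x n = iota y n) -> x = y.
Hypothesis iotaD : forall x y n, iota (x + y) n = iota x n + iota y n.
Hypothesis iotaM : forall x y, laurent_mul_rel (iota x) (iota y) (iota (x * y)).
Hypothesis iotaC : forall (c : K) n, iota (j (tofrac c%:P)) n = c * laurent_delta K 0 n.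
Hypothesis iotaX : forall n, iota (j (tofrac 'X)) n = laurent_delta K 1 n.
Local Notation jp p := (j (tofrac p)).

Definition integral (f : L) := forall n : int, n < 0 -> iota f n = 0.
Definition truncate N (f : L) : {poly K} := \poly_(r < N) iota f r%:Z.

Lemma iota0 n : iota 0 n = 0.
Proof. by apply: (addrI (iota 0 n)); rewrite -iotaD !addr0. Qed.

Lemma iota_sum (I : Type) (r : seq I) (P : pred I) (E : I -> L) n :
  iota (\sum_(i <- r | P i) E i) n = \sum_(i <- r | P i) iota (E i) n.
Proof. exact: (big_morph (iota^~ n) (fun x y => iotaD x y n) (iota0 n)). Qed.

Lemma integral_mul_coef f g (n : nat) : integral f -> integral g ->
  iota (f * g) n%:Z = \sum_(i < n.+1) iota f i%:Z * iota g (n - i)%N%:Z.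
Proof.
move=> If Ig; rewrite (@iotaM f g 0 0 If Ig) addr0 lez_nat leq0n !subr0 absz_nat.
apply: eq_bigr => i _; rewrite add0r; congr (_ * iota _ _).
by rewrite subzn // -ltnS.
Qed.

Lemma integralM f g : integral f -> integral g -> integral (f * g).
Proof.
move=> If Ig n n0; rewrite (@iotaM f g 0 0 If Ig) addr0.
by rewrite Order.POrderTheory.lt_geF.
Qed.

Lemma iota_poly p : integral (jp p) /\ forall n : nat, iota (jp p) n%:Z = p`_n.
Proof.
have IX : integral (jp 'X).
  by move=> n n0; rewrite iotaX /laurent_delta; case: eqP n0 => // ->.
elim/poly_ind: p => [|p c [Ip cp]].
  by rewrite !rmorph0; split=> n *; rewrite iota0 ?coef0.
have Ic : integral (jp c%:P).
  by move=> n n0; rewrite iotaC /laurent_delta; case: eqP n0 => [->//|]; rewrite mulr0.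
have jE : jp (p * 'X + c%:P) = jp p * jp 'X + jp c%:P by rewrite !(rmorphD, rmorphM).
split=> n; rewrite jE iotaD; first by move=> n0; rewrite (integralM Ip IX) // Ic // addr0.
rewrite integral_mul_coef // coefD coefMX coefC iotaC /laurent_delta.
congr (_ + _); last by case: n => [|n]; rewrite ?mulr1 ?mulr0.
case: n => [|n] /=; first by rewrite big_ord1 iotaX /laurent_delta mulr0.
rewrite (bigD1 (inord n)) //= inordK // subSnn iotaX /laurent_delta eqxx mulr1 cp.
rewrite big1 ?addr0 // => i ne; rewrite iotaX /laurent_delta ifF ?mulr0 //.
apply/negbTE; apply: contra ne => /eqP[] e; rewrite -val_eqE /= inordK //.
have le : (i <= n.+1)%N by rewrite -ltnS.
by have := subnKC le; rewrite e addn1 => -[->].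
Qed.

Lemma coef_truncate N f m : (m < N)%N -> (truncate N f)`_m = iota f m%:Z.
Proof. by move=> lt; rewrite coef_poly lt. Qed.

Lemma truncateM N f g m : integral f -> integral g -> (m < N)%N ->
  (truncate N (f * g))`_m = (truncate N f * truncate N g)`_m.
Proof.
move=> If Ig lt; rewrite coef_truncate // integral_mul_coef // coefM.
apply: eq_bigr => i _; rewrite !coef_truncate //.
  by apply: leq_ltn_trans lt; apply: leq_subr.
by apply: leq_ltn_trans lt; rewrite -ltnS.
Qed.

Lemma truncate_poly N p m : (m < N)%N -> (truncate N (jp p))`_m = p`_m.
Proof. by move=> lt; rewrite coef_truncate //; have [_ ->] := iota_poly p. Qed.

Lemma truncate_sum N (I : finType) (E : I -> L) :
  truncate N (\sum_i E i) = \sum_i truncate N (E i).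
Proof.
apply/polyP => m; rewrite coef_sum; have [lt|ge] := ltnP m N.
  by rewrite coef_truncate // iota_sum; apply: eq_bigr => i _; rewrite coef_truncate.
by rewrite coef_poly ltnNge ge /= big1 // => i _; rewrite coef_poly ltnNge ge.
Qed.

Lemma integral_scaling (I : finType) (e : I -> L) :
  exists M, forall i, integral (jp 'X^M * e i).
Proof.
have [b bP] := choice (fun i => iota_valid (e i)).
exists (\sum_i absz (b i))%N => i n n0; set M := (\sum_i _)%N.
have XM m : m < M%:Z -> iota (jp 'X^M) m = 0.
  have [IX cX] := iota_poly 'X^M; case: m => [m|m] lt; last exact: IX.
  by rewrite cX coefXn ltn_eqF // -ltz_nat.
rewrite (@iotaM _ _ M%:Z (b i) XM (bP i)) ifF //.
apply/negbTE; rewrite -Order.TotalTheory.ltNge; apply: (Order.POrderTheory.lt_le_trans n0).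
have le : (absz (b i) <= M)%N by rewrite /M (bigD1 i) //= leq_addr.
case: (b i) le => // m le; by rewrite NegzE Num.Theory.subr_ge0 lez_nat.
Qed.

(* The coefficients are separated by the residue of the exponent modulo [l]. *)
Lemma shifted_truncations_independent (I : finType) (e : I -> L) (l D : nat)
    (a : I * 'I_D.+1 -> K) : (0 < l)%N -> (forall i, integral (e i)) ->
  (forall c : I -> {fraction {poly K}}, \sum_i j (c i) * e i = 0 -> forall i, c i = 0) ->
  (forall m : nat, \sum_ki a ki *
     (\sum_(r < m.+1) iota (e ki.1) r%:Z * (m == ki.2 + l * r)%N%:R) = 0) ->
  forall ki, a ki = 0.
Proof.
move=> l0 Ie free rel [k0 i0]; set rho := (i0 %% l)%N.
have rhol : (rho < l)%N by rewrite ltn_mod.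
pose a' k (i : nat) := if (i < D.+1)%N then a (k, inord i) else 0.
(* In [sum a(k,i) T^i e_k(T^l)], exponents congruent to [rho] modulo [l] come only from
   [i = rho + l * i']. They form [T^rho] times [sum_k P_k e_k] evaluated at [t = T^l]. *)
pose P k : {poly K} := \poly_(i < D.+1) a' k (rho + l * i)%N.
have coefP k i : (P k)`_i = a' k (rho + l * i)%N.
  rewrite coef_poly; case: ltnP => // ge; rewrite /a' ifF //; apply/negbTE; rewrite -leqNgt.
  by apply: leq_trans ge _; apply: leq_trans (leq_addl _ _); apply: leq_pmull.
have key k (u : nat) : \sum_(i < D.+1) a (k, i) *
    (\sum_(r < (rho + l * u).+1) iota (e k) r%:Z * (rho + l * u == i + l * r)%N%:R) =
    iota (jp (P k) * e k) u%:Z.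
  set m := (rho + l * u)%N; have [IP cP] := iota_poly (P k).
  rewrite [jp (P k) * _]mulrC integral_mul_coef //.
  under eq_bigr do rewrite mulr_sumr; rewrite exchange_big /=.
  have leum : (u.+1 <= m.+1)%N.
    by rewrite ltnS; apply: leq_trans (leq_addl _ _); apply: leq_pmull.
  pose E r := iota (e k) r%:Z * (P k)`_(u - r).
  transitivity (\sum_(r < u.+1) E r); last by apply: eq_bigr => r _; rewrite /E cP.
  rewrite (big_ord_widen _ E leum) [RHS]big_mkcond /=; apply: eq_bigr => r _.
  have [ru|ur] := ltnP r u.+1.
    rewrite /E coefP.
    have mE i : (m == i + l * r)%N = (i == rho + l * (u - r))%N.
      have le : (l * r <= l * u)%N by rewrite leq_pmul2l // -ltnS.
      rewrite mulnBr addnBA // -[in RHS](eqn_add2r (l * r)%N) subnK 1?eq_sym //.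
      by apply: leq_trans le (leq_addl _ _).
    under eq_bigr => i _ do rewrite mE mulrCA.
    rewrite -mulr_sumr; congr (_ * _); rewrite /a'; case: ltnP => [lt|ge].
      rewrite -[RHS](sum_mul_delta (fun i => a (k, i))); apply: eq_bigr => i _.
      by congr (_ * _%:R); rewrite -val_eqE /= inordK.
    rewrite big1 // => i _; rewrite ltn_eqF ?mulr0 //.
    by apply: leq_trans ge; apply: ltn_ord.
  rewrite big1 // => i _; rewrite ltn_eqF ?mulr0 //.
  apply: (@leq_trans (l * u.+1)); first by rewrite mulnS /m ltn_add2r.
  by apply: leq_trans (leq_addl _ _); rewrite leq_pmul2l.
have /free/(_ k0)/eqP : \sum_k j (tofrac (P k)) * e k = 0.
  apply: iota_inj => n; rewrite iota0 iota_sum.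
  case: n => [u|u]; last first.
    by rewrite big1 // => k _; apply: integralM => //; case: (iota_poly (P k)).
  rewrite -[RHS](rel (rho + l * u)%N).
  rewrite (reindex (fun p : I * 'I_D.+1 => (p.1, p.2))) /=; last by exists id => [[]|[]].
  rewrite -(pair_bigA _ (fun k i => a (k, i) *
    (\sum_(r < (rho + l * u).+1) iota (e k) r%:Z * (rho + l * u == i + l * r)%N%:R))) /=.
  by apply: eq_bigr => k _; rewrite key.
rewrite tofrac_eq0 => /eqP/polyP/(_ (i0 %/ l)%N); rewrite coefP coef0 /a'.
have -> : (rho + l * (i0 %/ l))%N = i0 by rewrite mulnC addnC -divn_eq.
by rewrite ltn_ord inord_val.
Qed.

End LaurentTruncation.

Lemma coef_sum_powers (R : nzRingType) (a : nat -> R) (l N i0 : nat) : (0 < l)%N -> (i0 < N)%N ->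
  (\sum_(i < N) (a i)%:P * 'X^(l * i))`_(l * i0) = a i0.
Proof.
move=> l0 lt; rewrite coef_sum -[RHS](sum_mul_delta (fun i : 'I_N => a i) (Ordinal lt)).
by apply: eq_bigr => i _; rewrite coefCM coefXn eqn_pmul2l // eq_sym.
Qed.

(** * The tensor product is a division ring *)

Section TensorDivision.
Variables (h H : unitRingType) (A : h -> Prop) (sg : h -> h).
Variables (phi : {rmorphism h -> H}) (T : H).
Hypotheses (dh : is_divring h) (dH : is_divring H).
Hypotheses (sA : subdivring A) (autA : ring_aut_on A sg).
Hypothesis commT : forall a, A a -> T * phi a = phi (sg a) * T.
Hypothesis indT : forall (m : nat) (c : nat -> h), (forall i, A (c i)) ->
  \sum_(i < m) phi (c i) * T ^+ i = 0 -> forall i, (i < m)%N -> c i = 0.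
Variables (K L : fieldType) (kappa : {rmorphism K -> h}) (l : nat).
Variables (D : base_change {fraction {poly K}} L H) (iota : L -> int -> K).
Local Notation j := (bc_j D).
Local Notation e := (bc_basis (b := D)).
Local Notation n := (bc_dim D).
Hypothesis iota_valid : forall x, laurent_valid (iota x).
Hypothesis iota_inj : forall x y, (forall n, iota x n = iota y n) -> x = y.
Hypothesis iotaD : forall x y n, iota (x + y) n = iota x n + iota y n.
Hypothesis iotaM : forall x y, laurent_mul_rel (iota x) (iota y) (iota (x * y)).
Hypothesis iotaC : forall (c : K) n, iota (j (tofrac c%:P)) n = c * laurent_delta K 0 n.
Hypothesis iotaX : forall n, iota (j (tofrac 'X)) n = laurent_delta K 1 n.
Hypotheses (l_gt0 : (0 < l)%N) (kappaA : forall c, A (kappa c)).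
Hypothesis gammaC : forall c, bc_gamma D (tofrac c%:P) = phi (kappa c).
Hypothesis gammaX : bc_gamma D (tofrac 'X) = T ^+ l.

Local Notation gam := (bc_gamma D).
Local Notation ev := (skew_eval phi T).
Local Notation O := (skew_poly A phi T).
Local Notation I_ := (skew_ideal A phi T).
Local Notation jp p := (j (tofrac p)).
Local Notation gp p := (gam (tofrac p)).
Local Notation trunc := (truncate iota).

Lemma gpE (q : {poly K}) N : (size q <= N)%N ->
  gp q = \sum_(i < N) phi (kappa q`_i) * T ^+ (l * i).
Proof.
move=> sq; have qE : q = \sum_(i < N) (q`_i)%:P * 'X^i.
  rewrite -{1}[q]coefK poly_def (big_ord_widen _ (fun i => q`_i *: 'X^i) sq) big_mkcond.
  apply: eq_bigr => i _; rewrite mul_polyC; case: ltnP => // ge.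
  by rewrite nth_default // scale0r.
rewrite {1}qE !rmorph_sum; apply: eq_bigr => i _.
by rewrite !rmorphM /= !rmorphXn /= gammaC gammaX exprM.
Qed.

Lemma skew_poly_gp q : O (gp q).
Proof.
rewrite (gpE (leqnn _)); apply: (skew_poly_sum sA) => i.
apply: (skew_polyM sA autA commT); first exact: skew_poly_phi.
exact/(skew_polyX sA autA commT)/(skew_polyT _ _ sA).
Qed.

Lemma gp_congr N (p q : {poly K}) : (forall m, (m < N)%N -> p`_m = q`_m) -> I_ N (gp p - gp q).
Proof.
move=> pq; rewrite -!rmorphB -[p - q](poly_take_drop N).
have -> : take_poly N (p - q) = 0.
  apply/polyP => m; rewrite coef_take_poly coef0 coefB; case: ifP => // /pq->.
  by rewrite subrr.
rewrite add0r !rmorphM /= !rmorphXn /= gammaX -exprM.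
(* The difference is divisible by [T^(l * N)]; the weaker exponent [N] lets one index control both
   truncation and ideal. *)
apply: (@skew_ideal_le _ _ _ _ _ sA N (l * N)); first exact: leq_pmull.
by apply/skew_idealP; exists (gp (drop_poly N (p - q))) => //; apply: skew_poly_gp.
Qed.

Lemma gp_not_ideal q : q != 0 -> exists N, ~ I_ N (gp q).
Proof.
move=> nzq; pose i0 := (size q).-1.
have s0 : (i0 < size q)%N by rewrite prednK // size_poly_gt0.
pose Q : {poly h} := \sum_(i < size q) (kappa q`_i)%:P * 'X^(l * i).
have AQ : coefs_in A Q.
  apply: coefs_in_sum => // i; apply: coefs_inM => //; last exact: coefs_inXn.
  exact: coefs_inC.
have evQ : gp q = ev Q.
  rewrite (gpE (leqnn _)) ev_sum; apply: eq_bigr => i _.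
  by rewrite evCM -['X^_]mul1r evMXn -[1]/(1%:P) evC rmorph1 mul1r.
exists (l * i0).+1; rewrite evQ => /(skew_ideal_coef sA indT AQ)/(_ (ltnSn _))/eqP.
rewrite (coef_sum_powers (fun i => kappa q`_i)) //.
by rewrite fmorph_eq0 lead_coef_eq0 (negPf nzq).
Qed.

(** Truncating after [T^m] leaves the coefficient of [T^m] exact, and it is linear in the
    coefficients of the [p k] with factors from [K]. Over [K] the system has only the zero solution
    as the [f k] are free over [K(t)]; extension of scalars carries this to [h]. *)
Lemma truncated_combination_injective (p : 'I_n -> {poly h}) (f : 'I_n -> L) :
  (forall k, coefs_in A (p k)) -> (forall k, integral iota (f k)) ->
  (forall c : 'I_n -> {fraction {poly K}}, \sum_i j (c i) * f i = 0 -> forall i, c i = 0) ->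
  (forall N, I_ N (\sum_k ev (p k) * gp (trunc N (f k)))) -> forall k, p k = 0.
Proof.
move=> Ap If free inI.
pose d := \max_k size (p k).
have sp k : (size (p k) <= d.+1)%N by apply: leqW; apply: leq_bigmax.
suff H0 (ki : 'I_n * 'I_d.+1) : (p ki.1)`_ki.2 = 0.
  move=> k; apply/polyP => i; rewrite coef0; have [lt|ge] := ltnP i d.+1.
    exact: (H0 (k, Ordinal lt)).
  by rewrite nth_default // (leq_trans (sp k)).
move: ki; apply: (@independent_scalar_extension K nat ('I_n * 'I_d.+1)%type
  (fun m ki => \sum_(r < m.+1) iota (f ki.1) r%:Z * (m == ki.2 + l * r)%N%:R) h kappa
  (fun ki => (p ki.1)`_ki.2)).
  move=> a; exact: (shifted_truncations_independent iota_inj iotaD iotaM iotaC iotaX l_gt0 If free).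
move=> m.
pose Q : {poly h} := \sum_(k < n) \sum_(i < d.+1) \sum_(r < m.+1)
  ((p k)`_i * kappa (iota (f k) r%:Z))%:P * 'X^(i + l * r).
have AQ : coefs_in A Q.
  do 3![apply: coefs_in_sum => // ?]; apply: coefs_inM => //; last exact: coefs_inXn.
  by apply: coefs_inC => //; apply: (subdivringM sA); [apply: Ap | apply: kappaA].
have evQ : ev Q = \sum_k ev (p k) * gp (trunc m.+1 (f k)).
  rewrite ev_sum; apply: eq_bigr => k _; rewrite (ev_wide _ _ (sp k)) ev_sum mulr_suml.
  apply: eq_bigr => i _; rewrite (@gpE _ m.+1) ?size_poly // ev_sum mulr_sumr.
  apply: eq_bigr => r _; rewrite evCM -['X^_]mul1r evMXn -[1]/(1%:P) evC rmorph1 mul1r.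
  rewrite coef_truncate ?ltn_ord // rmorphM exprD -!mulrA; congr (_ * _).
  by rewrite !mulrA -gammaC bc_central.
have := skew_ideal_coef sA indT AQ _ (ltnSn m); rewrite evQ => /(_ (inI _)) Qm.
rewrite -[RHS]Qm coef_sum.
rewrite (reindex (fun p : 'I_n * 'I_d.+1 => (p.1, p.2))) /=; last by exists id => [[]|[]].
rewrite -(pair_bigA _ (fun k (i : 'I_d.+1) => (p k)`_i * kappa
   (\sum_(r < m.+1) iota (f k) r%:Z * (m == i + l * r)%N%:R))) /=.
apply: eq_bigr => k _; rewrite coef_sum; apply: eq_bigr => i _.
rewrite coef_sum rmorph_sum mulr_sumr; apply: eq_bigr => r _.
by rewrite coefCM coefXn rmorphM rmorph_nat mulrA.
Qed.

(** [hat z N] stands for [s^M z] modulo [T^N]. From [x * y = 0], a fixed multiple of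
    [hat x N * hat y N] lies in the ideal of [T^N] for every [N], while for nonzero [x] and [y] its
    order stays bounded. *)
Lemma tensor_poly_domain (x y : tensor D) :
  (forall k, O (tcoord x k)) -> (forall k, O (tcoord y k)) -> x * y = 0 ->
  x = 0 \/ y = 0.
Proof.
move=> Ox Oy xy0.
have [M IM] := integral_scaling iota_valid iotaD iotaM iotaC iotaX e.
pose e' k := jp 'X^M * e k.
have Ie k : integral iota (e' k) by apply: IM.
have free (c : 'I_n -> {fraction {poly K}}) : \sum_i j (c i) * e' i = 0 -> forall i, c i = 0.
  move=> rel i; have : c i * tofrac 'X^M = 0.
    rewrite -[LHS](bc_coord_uniq (b := D) (fun i => c i * tofrac 'X^M) i).
    have -> : \sum_i j (c i * tofrac 'X^M) * e i = j 0 * 0.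
      by rewrite mulr0 -[RHS]rel; apply: eq_bigr => k _; rewrite rmorphM -mulrA.
    by rewrite coordZ mul0r.
  by move/eqP; rewrite mulf_eq0 tofrac_eq0 expf_eq0 polyX_eq0 andbF orbF => /eqP.
pose hat (z : tensor D) N := \sum_k tcoord z k * gp (trunc N (e' k)).
have hatO z N : (forall k, O (tcoord z k)) -> O (hat z N).
  move=> Oz; apply: (skew_poly_sum sA) => k; apply: (skew_polyM sA autA commT) => //.
  exact: skew_poly_gp.
have hat_nz z : (forall k, O (tcoord z k)) -> z <> 0 -> exists N, ~ I_ N (hat z N).
  move=> Oz nz; apply: contrapT => allI; apply: nz.
  have [p pP] := choice (fun k => let: ex_intro2 p Ap e := Oz k in
    ex_intro (fun p => coefs_in A p /\ tcoord z k = ev p) p (conj Ap e)).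
  apply: tcoordP => k; rewrite tcoord0; have [_ ->] := pP k.
  rewrite (@truncated_combination_injective p e') ?ev0 //.
  - by move=> k'; case: (pP k').
  - move=> N; apply: contrapT => nI; apply: allI; exists N; rewrite /hat.
    by under eq_bigr => k' _ do rewrite (proj2 (pP k')).
have hat_le z N N' : (forall k, O (tcoord z k)) -> (N <= N')%N ->
    ~ I_ N (hat z N) -> ~ I_ N (hat z N').
  move=> Oz le nI I'; apply: nI; rewrite -[hat z N](subKr (hat z N')).
  apply: (skew_idealB sA) => //; rewrite /hat -sumrB; apply: (skew_ideal_sum sA) => k.
  rewrite -mulrBr; apply: (skew_idealMl sA autA commT) => //.
  by apply: gp_congr => m lt; rewrite !coef_truncate // (leq_trans lt).
(* [r] clears the denominators of all structure constants, so that the multiplication table of [L]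
   can be truncated. *)
have [r nzr rP] := frac_common_denominator
  (fun abk : 'I_n * 'I_n * 'I_n => bc_coord (b := D) (e abk.1.1 * e abk.1.2) abk.2).
have [P PP] := choice rP.
(* Truncated form of [r e'_a e'_b = sum_k P_abk t^M e'_k]: one of the two factors [t^M] is absorbed
   into [e'_k]. *)
have prodE N a b : I_ N (gp (r * trunc N (e' a) * trunc N (e' b)) -
    \sum_k gp (P (a, b, k) * 'X^M * trunc N (e' k))).
  rewrite -!rmorph_sum; apply: gp_congr => m lt.
  have Ir q : integral iota (jp q) by case: (iota_poly iotaD iotaM iotaC iotaX q).
  have tcong (q : {poly K}) s (t : {poly K}) : integral iota s ->
      (forall i, (i < N)%N -> t`_i = (trunc N s)`_i) ->
      (q * t)`_m = (trunc N (jp q * s))`_m.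
    move=> Is tt; rewrite truncateM // !coefM; apply: eq_bigr => i _.
    have lti : (i < N)%N by apply: leq_ltn_trans lt; rewrite -ltnS.
    by rewrite truncate_poly // tt // (leq_ltn_trans (leq_subr _ _) lt).
  rewrite -mulrA (@tcong r (e' a * e' b)); last first.
  - by move=> i lti; rewrite (truncateM iotaM (Ie a) (Ie b) lti).
  - exact: (integralM iotaM (Ie a) (Ie b)).
  have -> : jp r * (e' a * e' b) = \sum_k jp (P (a, b, k) * 'X^M) * e' k.
    rewrite /e' mulrACA [e a * e b](bc_coordK D) mulrA mulr_sumr.
    apply: eq_bigr => k _; rewrite !rmorphM /= -PP /= !rmorphM /=.
    set w1 := jp r; set w2 := jp 'X^M; set w3 := j _; set w4 := e k.
    rewrite [w1 * (w2 * w2)]mulrA -!mulrA; congr (_ * _).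
    by rewrite [w3 * (w2 * _)]mulrCA; congr (_ * _); rewrite mulrCA.
  rewrite truncate_sum // !coef_sum; apply: eq_bigr => k _.
  by rewrite (@tcong _ (e' k)).
have hatM N : I_ N (gp r * (hat x N * hat y N)).
  have -> : gp r * (hat x N * hat y N) = \sum_a \sum_b tcoord x a * tcoord y b *
      gp (r * trunc N (e' a) * trunc N (e' b)).
    rewrite /hat mulr_suml mulr_sumr; apply: eq_bigr => a _.
    rewrite !mulr_sumr; apply: eq_bigr => b _.
    rewrite bc_central -[_ * gp _ * _]mulrA (bc_central D _ (tcoord y b * _)) -!mulrA.
    rewrite -!rmorphM; congr (_ * (_ * gp _)).
    by rewrite [RHS]mulrC mulrA [_ * trunc N (e' a)]mulrC.
  (* Regrouped by [k], this sum is built from the coordinates of [x * y], which vanish. *)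
  have z0 : \sum_a \sum_b tcoord x a * tcoord y b *
      \sum_k gp (P (a, b, k) * 'X^M * trunc N (e' k)) = 0.
    transitivity (\sum_k tcoord (x * y) k * gp (r * 'X^M * trunc N (e' k))).
      under [RHS]eq_bigr do rewrite tcoordM mulr_suml.
      rewrite [RHS]exchange_big /=; apply: eq_bigr => a _.
      under [RHS]eq_bigr do rewrite mulr_suml.
      rewrite [RHS]exchange_big /=; apply: eq_bigr => b _.
      rewrite mulr_sumr; apply: eq_bigr => k _; rewrite -[RHS]mulrA; congr (_ * _).
      by rewrite -rmorphM; congr (gam _); rewrite !rmorphM /= -PP /= !mulrA [_ * tofrac r]mulrC.
    by rewrite xy0 big1 // => k _; rewrite tcoord0 mul0r.
  rewrite -[X in I_ _ X]subr0 -[X in _ - X]z0 -sumrB; apply: (skew_ideal_sum sA) => a.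
  rewrite -sumrB; apply: (skew_ideal_sum sA) => b; rewrite -mulrBr.
  by apply: (skew_idealMl sA autA commT) => //; apply: (skew_polyM sA autA commT).
apply: contrapT => /not_orP[nzx nzy].
have [N0 n0] := gp_not_ideal nzr.
have [N1 n1] := hat_nz x Ox nzx; have [N2 n2] := hat_nz y Oy nzy.
have prime := skew_ideal_prime dh dH sA autA commT indT.
(* This index is fine enough for both truncations and equals the sum of the three order bounds. *)
apply: (prime N0 (N1 + N2)%N _ _ (skew_poly_gp r)) (hatM (N0 + (N1 + N2))%N) => //.
  by apply: (skew_polyM sA autA commT); apply: hatO.
apply: prime; try exact: hatO.
  by apply: hat_le n1 => //; rewrite addnCA leq_addr.
by apply: hat_le n2 => //; rewrite addnA leq_addl.
Qed.

(** Denominators are restricted to the central ring [K[s]], so that, unlike those of [skew_frac],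
    they survive products of tensors. *)
Definition localized (z : H) := exists2 q : {poly K}, q != 0 & O (gp q * z).
Definition tlocalized (x : tensor D) := forall k, localized (tcoord x k).

Lemma gp_neq0 q : q != 0 -> gp q != 0.
Proof. by move=> nz; rewrite fmorph_eq0 tofrac_eq0. Qed.

Lemma localized_poly z : O z -> localized z.
Proof. by move=> Oz; exists 1; rewrite ?oner_neq0 // !rmorph1 mul1r. Qed.

Lemma localized_gamma c : localized (gam c).
Proof.
have [p [q [nzq e]]] := fracP c; exists q => //.
by rewrite -rmorphM e; apply: skew_poly_gp.
Qed.

Lemma localizedD x y : localized x -> localized y -> localized (x + y).
Proof.
move=> [p nzp Op] [q nzq Oq]; exists (p * q); first by rewrite mulf_neq0.
rewrite mulrDr; apply: (skew_polyD sA).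
  by rewrite mulrC !rmorphM /= -mulrA; apply: (skew_polyM sA autA commT) => //; apply: skew_poly_gp.
by rewrite !rmorphM /= -mulrA; apply: (skew_polyM sA autA commT) => //; apply: skew_poly_gp.
Qed.

Lemma localizedM x y : localized x -> localized y -> localized (x * y).
Proof.
move=> [p nzp Op] [q nzq Oq]; exists (p * q); first by rewrite mulf_neq0.
have -> : gp (p * q) * (x * y) = (gp p * x) * (gp q * y).
  by rewrite !rmorphM /= -!mulrA; congr (_ * _); rewrite !mulrA bc_central.
exact: (skew_polyM sA autA commT).
Qed.

Lemma localized_sum (I : Type) (r : seq I) (P : pred I) (E : I -> H) :
  (forall i, localized (E i)) -> localized (\sum_(i <- r | P i) E i).
Proof.
move=> LE; apply: (big_ind localized) => //; last exact: localizedD.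
exact/localized_poly/(skew_poly0 _ _ sA).
Qed.

Lemma localized_frac z : localized z -> skew_frac A phi T z.
Proof. by move=> [q nzq Oq]; exists (gp q); split=> //; [apply: skew_poly_gp | apply: gp_neq0]. Qed.

Lemma tlocalizedM x y : tlocalized x -> tlocalized y -> tlocalized (x * y).
Proof.
move=> Lx Ly k; rewrite tcoordM; do 2![apply: localized_sum => ?].
by apply: localizedM; [apply: localizedM | apply: localized_gamma].
Qed.

Lemma tlocalizedX x m : tlocalized x -> tlocalized (x ^+ m).
Proof.
move=> Lx; elim: m => [|m IH]; last by rewrite exprS; apply: tlocalizedM.
by move=> k; rewrite expr0 -tz11 tcoord_tz mul1r; apply: localized_gamma.
Qed.

Lemma tlocalized_left a x : localized a -> tlocalized x -> tlocalized (tleft D a * x).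
Proof. by move=> La Lx k; rewrite tcoord_left; apply: localizedM. Qed.

Lemma tlocalized_sum (I : Type) (r : seq I) (P : pred I) (E : I -> tensor D) :
  (forall i, tlocalized (E i)) -> tlocalized (\sum_(i <- r | P i) E i).
Proof. by move=> LE k; rewrite tcoord_sum; apply: localized_sum => i; apply: LE. Qed.

Lemma tleft_regular a (x : tensor D) : a != 0 -> tleft D a * x = 0 -> x = 0.
Proof.
move=> nza /(congr1 ( *%R (tleft D a^-1))).
by rewrite mulr0 mulrA -rmorphM mulVr ?rmorph1 ?mul1r //; apply: dH.
Qed.

Lemma tlocalized_scaling x : tlocalized x ->
  exists2 q : {poly K}, q != 0 & forall k, O (tcoord (tleft D (gp q) * x) k).
Proof.
move=> Lx; have [q qP] := choice (fun k => let: ex_intro2 q nz Oq := Lx k in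
  ex_intro (fun q : {poly K} => q != 0 /\ O (gp q * tcoord x k)) q (conj nz Oq)).
exists (\prod_k q k); first by apply/prodf_neq0 => k _; case: (qP k).
move=> k; rewrite tcoord_left (bigD1 k) //= mulrC !rmorphM /= -mulrA.
by apply: (skew_polyM sA autA commT); [apply: skew_poly_gp | case: (qP k)].
Qed.

Lemma tlocalized_domain x y : tlocalized x -> tlocalized y -> x * y = 0 -> x = 0 \/ y = 0.
Proof.
move=> /tlocalized_scaling[p nzp Op] /tlocalized_scaling[q nzq Oq] xy0.
have [|x0|y0] := tensor_poly_domain Op Oq.
- rewrite -[in X in _ * X]tright_base mulrA -tright_central !mulrA -[_ * x * y]mulrA xy0.
  by rewrite mulr0.
- by left; apply: tleft_regular x0; apply: gp_neq0.
- by right; apply: tleft_regular y0; apply: gp_neq0.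
Qed.

(** A nonzero [c 0] gives the left inverse at once. Otherwise the relation is one of lower degree
    times [x], and [x] cancels because both factors have central denominators. *)
Lemma relation_left_inverse (x : tensor D) (m : nat) (c : nat -> H) :
  tlocalized x -> x <> 0 -> (forall i, O (c i)) -> (exists2 i, (i < m)%N & c i != 0) ->
  \sum_(i < m) tleft D (c i) * x ^+ i = 0 -> exists y, y * x = 1.
Proof.
move=> Lx nzx; elim: m c => [|m IH] c Oc [i0 lt nz] //.
rewrite big_ord_recl mulr1; under eq_bigr do rewrite lift0 exprSr mulrA.
rewrite -mulr_suml => rel.
have [c0|nz0] := eqVneq (c 0%N) 0; last first.
  exists (- (tleft D (c 0%N)^-1 * \sum_(i < m) tleft D (c i.+1) * x ^+ i)).
  rewrite mulNr -mulrA; apply/eqP; rewrite -mulrN.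
  move/eqP: rel; rewrite addrC addr_eq0 => /eqP ->; rewrite opprK -rmorphM mulVr ?rmorph1 //.
  exact: dH.
move: rel; rewrite c0 rmorph0 add0r => /tlocalized_domain[] //.
  apply: tlocalized_sum => i; apply: tlocalized_left; last exact: tlocalizedX.
  exact: localized_poly.
apply: (IH (fun i => c i.+1)) => //.
by case: i0 lt nz => [|i0] lt nz; [rewrite c0 eqxx in nz | exists i0].
Qed.

Lemma tensor_left_inverse (x : tensor D) :
  (forall k, skew_frac A phi T (tcoord x k)) -> x <> 0 -> exists y, y * x = 1.
Proof.
have sfrac := skew_frac_subdivring dh dH sA autA commT indT.
have denom := common_denominator dh dH sA autA commT indT.
move=> fx nzx; have [a [Oa nza Oax]] := denom _ _ fx.
pose X := tleft D a * x.
have LX : tlocalized X by move=> k; rewrite tcoord_left; apply: localized_poly.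
have nzX : X <> 0 by move/tleft_regular => /(_ nza).
(* There are [n + 1] powers of [X] but [n] coordinates. The dependence is taken over [skew_frac], so
   that a left denominator [b] turns its coefficients into skew polynomials. *)
have [k i||c [fc [i0 nz] rel]] := @left_dependence H (skew_frac A phi T) 'I_n 'I_n.+1
  (fun k i => tcoord (X ^+ i) k) dH sfrac.
- exact/localized_frac/tlocalizedX.
- by rewrite !card_ord.
have [b [Ob nzb Obc]] := denom _ _ fc.
have [|||y yX] := @relation_left_inverse X n.+1
  (fun i => if (i < n.+1)%N then b * c (inord i) else 0) LX nzX.
- by move=> i; case: ifP => // _; apply: (skew_poly0 _ _ sA).
- by exists i0; rewrite ltn_ord // inord_val; apply: divring_mulf_neq0.
- apply: tcoordP => k; rewrite tcoord_sum tcoord0 -[RHS](mulr0 b) -[in RHS](rel k) mulr_sumr.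
  by apply: eq_bigr => i _; rewrite ltn_ord inord_val tcoord_left mulrA.
by exists (y * tleft D a); rewrite -mulrA.
Qed.

End TensorDivision.

(** * The direct limit *)

(** The image of a fraction is characterized by all its representations [q c = p] at once; the
    morphism laws then follow by clearing denominators. *)
Lemma frac_central_extension (R : idomainType) (H : unitRingType) (g : {rmorphism R -> H}) :
  is_divring H -> (forall x, g x = 0 -> x = 0) -> (forall x z, g x * z = z * g x) ->
  exists gam : {rmorphism {fraction R} -> H},
    (forall x, gam (tofrac x) = g x) /\ (forall a z, gam a * z = z * gam a).
Proof.
move=> dH g_inj g_cent.
have gU q : q != 0 -> g q \is a GRing.unit.
  by move=> nz; apply: dH; apply: contra_neq nz => /g_inj.
have ex (c : {fraction R}) : exists z, (forall p q, tofrac q * c = tofrac p -> g q * z = g p) /\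
    forall w, z * w = w * z.
  have [p [q [nzq e]]] := fracP c; exists (g p / g q); split.
    move=> p' q' e'.
    have eqpq : q' * p = q * p'.
      by apply/eqP; rewrite -tofrac_eq !rmorphM /= -e -e' mulrCA.
    by rewrite mulrA -rmorphM eqpq rmorphM g_cent mulrK // gU.
  move=> w; have cw : w * (g q)^-1 = (g q)^-1 * w.
    by apply: commrV; rewrite /GRing.comm g_cent.
  by rewrite -mulrA -cw mulrA g_cent mulrA.
have [gam gamP] := choice ex.
have gam1 p q c : tofrac q * c = tofrac p -> g q * gam c = g p by case: (gamP c) => + _; apply.
have gamC a z : gam a * z = z * gam a by case: (gamP a) => _.
have gamB : zmod_morphism gam.
  move=> c1 c2; have [p1 [q1 [n1 e1]]] := fracP c1; have [p2 [q2 [n2 e2]]] := fracP c2.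
  apply: (mulrI (gU (q1 * q2) (mulf_neq0 n1 n2))).
  rewrite (gam1 (q2 * p1 - q1 * p2)); last first.
    rewrite mulrBr !rmorphB !rmorphM /= -e1 -e2 !mulrA [tofrac q2 * _]mulrC.
    by [].
  rewrite mulrBr !rmorphB !rmorphM -(gam1 _ _ _ e1) -(gam1 _ _ _ e2) !mulrA.
  by rewrite [g q2 * _]g_cent.
have gamM : monoid_morphism gam.
  split=> [|c1 c2].
    by rewrite -[LHS]mul1r -(rmorph1 g) (gam1 1 1) // mulr1.
  have [p1 [q1 [n1 e1]]] := fracP c1; have [p2 [q2 [n2 e2]]] := fracP c2.
  apply: (mulrI (gU (q1 * q2) (mulf_neq0 n1 n2))).
  rewrite (gam1 (p1 * p2)); last by rewrite !rmorphM /= -e1 -e2 mulrACA.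
  rewrite !rmorphM -(gam1 _ _ _ e1) -(gam1 _ _ _ e2) -!mulrA; congr (_ * _).
  by rewrite !mulrA gamC.
pose gamZ := GRing.isZmodMorphism.Build _ _ gam gamB.
pose gamR := GRing.isMonoidMorphism.Build _ _ gam gamM.
pose G : {rmorphism {fraction R} -> H} := HB.pack gam gamZ gamR.
exists G; split=> [x|]; last exact: gamC.
by rewrite -[LHS]mul1r -(rmorph1 g) [LHS](gam1 x) // rmorph1 mul1r.
Qed.

Lemma gen_divring_centralizer (R : unitRingType) (S : R -> Prop) (z x : R) :
  (forall y, S y -> z * y = y * z) -> gen_divring S x -> z * x = x * z.
Proof.
move=> zS /(_ (fun x => z * x = x * z)); apply=> //; split.
- by rewrite mulr0 mul0r.
- by rewrite mulr1 mul1r.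
- by move=> a b za zb; rewrite mulrBr mulrBl za zb.
- by move=> a b za zb; rewrite mulrA za -mulrA zb mulrA.
- by move=> a za; apply: commrV.
Qed.

Lemma left_inverse_divring (R : unitRingType) :
  (forall x : R, x <> 0 -> exists y, y * x = 1) -> is_divring R.
Proof.
move=> linv x /eqP nzx; have [y yx] := linv x nzx.
have [z zy] : exists z, z * y = 1.
  apply: linv => y0; move: yx; rewrite y0 mul0r => /esym/eqP.
  by rewrite oner_eq0.
have zx : z = x by rewrite -[z]mulr1 -yx mulrA zy mul1r.
by apply/unitrP; exists y; rewrite -{2}zx.
Qed.

Section SkewLimit.
Variables (h : unitRingType) (hs : nat -> h -> Prop).
Variables (sigma : nat -> h -> h) (l : nat -> nat).
Variables (K : fieldType) (kappa : {rmorphism K -> h}).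
Variables (H : unitRingType) (phi : {rmorphism h -> H}) (T : nat -> H).
Hypotheses (dh : is_divring h) (hs_sub : forall n, subdivring (hs n)).
Hypothesis hs_mono : forall n x, hs n x -> hs n.+1 x.
Hypothesis hs_aut : forall n, ring_aut_on (hs n) (sigma n).
Hypothesis sigma_l : forall n x, hs n x -> iter (l n) (sigma n) x = x.
Hypotheses (kappa_hs : forall n c, hs n (kappa c)).
Hypothesis kappa_central : forall n c a, hs n a -> kappa c * a = a * kappa c.
Hypothesis kappa_fix : forall n c, sigma n (kappa c) = kappa c.
Hypotheses (l_gt0 : forall n, (0 < l n)%N) (l_dvd : forall n, (l n %| l n.+1)%N).
Hypothesis lim : is_skew_limit hs sigma l phi T.

Let dH : is_divring H. Proof. by case: lim. Qed.
Let T_step n : T n = T n.+1 ^+ (l n.+1 %/ l n). Proof. by case: lim. Qed.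
Let T_comm n a : hs n a -> T n * phi a = phi (sigma n a) * T n.
Proof. by case: lim => _ _ + _ _; apply. Qed.
Let T_free n (m : nat) (c : nat -> h) : (forall i, hs n (c i)) ->
  \sum_(i < m) phi (c i) * T n ^+ i = 0 -> forall i, (i < m)%N -> c i = 0.
Proof. by case: lim => _ _ _ + _; apply. Qed.
Let stage n x := gen_divring (fun y => y = T n \/ exists a, hs n a /\ y = phi a) x.

Lemma stage_mono n m x : (n <= m)%N -> stage n x -> stage m x.
Proof.
elim: m => [|m IH]; first by rewrite leqn0 => /eqP->.
rewrite leq_eqVlt => /predU1P[->//|lt] /(IH lt) sx P sP genP; apply: sx => // y [->|[a [ha ->]]].
  by rewrite T_step; apply: (subdivringX sP); apply: genP; left.
by apply: genP; right; exists a; split=> //; apply: hs_mono.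
Qed.

Lemma common_stage (I : finType) (x : I -> H) : exists n, forall i, stage n (x i).
Proof.
have [n nP] := choice (fun i => let: And5 _ _ _ _ H5 := lim in H5 (x i)).
exists (\max_i n i)%N => i; apply: stage_mono (nP i).
exact: leq_bigmax.
Qed.

Lemma central_power n : T n ^+ l n = T 0%N ^+ l 0%N.
Proof.
by elim: n => // n <-; rewrite (T_step n) -exprM divnK.
Qed.

Lemma central_parameter z : T 0%N ^+ l 0%N * z = z * T 0%N ^+ l 0%N.
Proof.
have [n nP] := common_stage (fun _ : unit => z).
apply: gen_divring_centralizer (nP tt) => y [->|[a [ha ->]]]; rewrite -(central_power n).
  by rewrite -exprS -exprSr.
have aux m : T n ^+ m * phi a = phi (iter m (sigma n) a) * T n ^+ m.
  elim: m => [|m IH]; first by rewrite mul1r mulr1.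
  rewrite exprS -mulrA IH mulrA T_comm -?mulrA //.
  exact: (aut_iter_closed (hs_aut n)).
by rewrite aux sigma_l.
Qed.

Lemma central_constant c z : phi (kappa c) * z = z * phi (kappa c).
Proof.
have [n nP] := common_stage (fun _ : unit => z).
apply: gen_divring_centralizer (nP tt) => y [->|[a [ha ->]]].
  by rewrite T_comm ?kappa_fix.
by rewrite -!rmorphM (kappa_central c ha).
Qed.

Lemma rational_functions_central :
  exists gam : {rmorphism {fraction {poly K}} -> H},
    [/\ forall c, gam (tofrac c%:P) = phi (kappa c),
        forall n, gam (tofrac 'X) = T n ^+ l n &
        forall a z, gam a * z = z * gam a].
Proof.
pose f : {rmorphism K -> H} := phi \o kappa.
have cfs : commr_rmorph f (T 0%N ^+ l 0%N) by move=> c; apply: central_parameter.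
pose g : {rmorphism {poly K} -> H} := horner_morph cfs.
have gE p : g p = \sum_(i < size p) phi (kappa p`_i) * T 0%N ^+ (l 0%N * i).
  rewrite -[g p]/((map_poly f p).[T 0%N ^+ l 0%N]).
  rewrite (@horner_coef_wide _ (size p)) ?size_poly //.
  by apply: eq_bigr => i _; rewrite coef_map exprM.
have [p||gam [gamE gamC]] := @frac_central_extension _ _ g dH.
(* Injectivity: [p] at [T_0^l_0] is the skew polynomial [Q], with the coefficients of [p] spread to
   exponents [l_0 * i], and powers of [T_0] are free. *)
- pose Q : {poly h} := \sum_(i < size p) (kappa p`_i)%:P * 'X^(l 0%N * i).
  have AQ : coefs_in (hs 0%N) Q.
    apply: (coefs_in_sum (hs_sub 0)) => i; apply: (coefs_inM (hs_sub 0)).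
      exact: (coefs_inC (hs_sub 0)).
    exact: (coefs_inXn (hs_sub 0)).
  rewrite gE => p0.
  have Q0 : Q = 0.
    apply: (ev_eq0 (@T_free 0%N) AQ); rewrite -[RHS]p0 ev_sum; apply: eq_bigr => i _.
    by rewrite evCM -['X^_]mul1r evMXn -[1]/(1%:P) evC rmorph1 mul1r.
  apply/polyP => i; rewrite coef0; have [lt|ge] := ltnP i (size p); last by rewrite nth_default.
  apply/eqP; rewrite -(fmorph_eq0 kappa) -(coef_sum_powers (fun i => kappa p`_i) (l_gt0 0) lt).
  by rewrite -/Q Q0 coef0.
- move=> p z; rewrite gE mulr_suml mulr_sumr; apply: eq_bigr => i _.
  rewrite -mulrA exprM; have -> : (T 0%N ^+ l 0%N) ^+ i * z = z * (T 0%N ^+ l 0%N) ^+ i.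
    by apply/commr_sym/commrX; rewrite /GRing.comm central_parameter.
  by rewrite !mulrA central_constant.
exists gam; split=> // [c|n]; rewrite gamE.
  by rewrite -[LHS]/((map_poly f c%:P).[_]) map_polyC hornerC.
by rewrite -[LHS]/((map_poly f 'X).[_]) map_polyX hornerX -(central_power n).
Qed.

Lemma skew_limit_IGP : SIGP K -> IGP H.
Proof.
move=> sigp gT G.
have [L [j [[iota [iv ii iD iM [iC iX]]] galL [f [fG fM f_inj f_all]]]]] := sigp gT G.
have [e [B [Be eB]]] := galois_action_dual_basis fG f_inj.
have [co [coK co_uniq]] := galois_basis_coordinates galL fG fM f_all Be eB.
have [gam [gamC gamX gam_central]] := rational_functions_central.
pose D := BaseChange gam_central coK co_uniq.
have dT : is_divring (tensor D).
  (* The coordinates of [x] lie in one stage, where the inverse is found; [D] is the same for all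
     stages because [s] is. *)
  apply: left_inverse_divring => x nzx; have [n nP] := common_stage (tcoord x).
  have Tf := @T_free n.
  apply: (@tensor_left_inverse _ _ _ _ _ _ dh dH (hs_sub n) (hs_aut n) (@T_comm n) Tf
    _ _ kappa (l n) D iota iv ii iD iM iC iX (l_gt0 n) (kappa_hs n) gamC (gamX n)) => // i.
  by apply: (gen_skew_frac dh dH (hs_sub n) (hs_aut n) (@T_comm n) Tf); apply: nP.
exists (tensor D), (tleft D : {rmorphism H -> tensor D}); split=> //.
- exact: tensor_outer.
- by apply: (@tensor_galois _ _ _ D gT G f enum_val B) => // i; apply: enum_valP.
- by apply: (@tensor_gal_group _ _ _ D gT G f enum_val B) => // i; apply: enum_valP.
Qed.

End SkewLimit.

Theorem theorem6
  (h : unitRingType) (k : h -> Prop) (hs : nat -> h -> Prop)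
  (sigma : nat -> h -> h) (d : nat -> nat)
  (K : fieldType) (kappa : {rmorphism K -> h}) :
  is_divring h -> subdivring k ->
  (forall n, subdivring (hs n)) ->
  (forall n x, k x -> hs n x) ->
  (forall n x, hs n x -> hs n.+1 x) ->
  (forall x, exists n, hs n x) ->
  (forall n, [/\ outer_ext (hs n) k, galois_ext (hs n) k,
                 left_degree (hs n) k (d n) & gal_cyclic_gen (hs n) k (sigma n)]) ->
  (forall m n, (m <= n)%N -> forall x, hs m x -> sigma n x = sigma m x) ->
  (forall n, coprime (d n.+1 %/ d n) (d n)) ->
  (forall c, k (kappa c)) ->
  (forall c a, k a -> kappa c * a = a * kappa c) ->
  (exists l, good_seq d l) /\
  (forall l, good_seq d l ->
     forall (H : unitRingType) (phi : {rmorphism h -> H}) (T : nat -> H),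
       is_skew_limit hs sigma l phi T -> SIGP K -> IGP H).
Proof.
move=> dh sk hs_sub k_hs hs_mono hs_union ext compat cop kappa_k kappa_comm.
have hs_aut n : ring_aut_on (hs n) (sigma n) by case: (ext n) => _ _ _ [[]].
have ord n m : (forall x, hs n x -> iter m (sigma n) x = x) <-> (d n %| m)%N.
  by case: (ext n) => out gal deg cyc;
    apply: (outer_cyclic_generator_order dh (hs_sub n) (k_hs n) out gal deg cyc).
have d_gt0 n : (0 < d n)%N.
  by case: (ext n) => out gal deg cyc;
    apply: (outer_cyclic_degree_gt0 dh (hs_sub n) (k_hs n) out deg cyc).
(* [sigma n.+1] restricts to [sigma n], so the power [d n.+1] of [sigma n] is trivial. *)
have d_dvd n : (d n %| d n.+1)%N.
  apply/ord => x hx; rewrite -[RHS](proj2 (ord n.+1 (d n.+1)) (dvdnn _) x (hs_mono _ _ hx)).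
  elim: (d n.+1) => //= m <-; rewrite (compat n n.+1) //.
  exact: (aut_iter_closed (hs_aut n)).
split; first exact: coprime_tower_good_seq.
move=> l good H phi T lim; apply: (skew_limit_IGP (kappa := kappa) dh hs_sub hs_mono hs_aut) lim.
- by move=> n x; move: x; apply/ord; case: (good n).
- by move=> n c; apply: k_hs.
- move=> n c a ha; have [->|nzc] := eqVneq c 0; first by rewrite rmorph0 mul0r mulr0.
  have nzk : kappa c != 0 by rewrite fmorph_eq0.
  case: (ext n) => out _ _ _.
  rewrite -{2}(out _ (k_hs n _ (kappa_k c)) nzk _ a ha) ?mulrVK ?dh // => b kb.
  by rewrite kappa_comm // mulrK // dh.
- by move=> n c; case: (ext n) => _ _ _ [[_ fixk] _]; apply: fixk.
- by move=> n; case: (good n).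
- by move=> n; case: (good n).
Qed.
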